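(* Let $M$ be a smooth $n$-dimensional manifold, $E=\mathbb R\times TM$ and let $\Gamma$ be a second-order differential equation field on $E$, with associated tensors $S,Q$ and projectors $P_\Gamma,P_H,P_V$. The Massa–Pagani connection, given for $X,Y\in\mathfrak X(E)$ by $$\begin{aligned}\hat\nabla_XY=\ &X(dt(Y))\Gamma+Q([P_H(X),S(Y)])+S([P_V(X),Q(Y)])\\&+P_H([X-P_H(X),P_H(Y)])+P_V([X-P_V(X),P_V(Y)]),\end{aligned}$$ is the unique linear connection on $E$ satisfying all of the following conditions, where $\hat T$ and $R$ denote the torsion and curvature of $\hat\nabla$: 1. $\hat\nabla\Gamma=0$ and $\hat\nabla dt=0$; 2. $\hat\nabla S=0$ and $\hat\nabla Q=0$; 3. $P_H(X)=\hat T(\Gamma,S(X))$ and $P_V(X)=S(\hat T(\Gamma,X))$ for all $X\in\mathfrak X(E)$; 4. $R(\Gamma,V)=0$ for every vertical vector field $V$; 5. $\hat\nabla_VU=0$ for every vertical $V$ and every $U$ that is vertical and constant along the (vertical) fibres, that is, a vertical lift from $\mathbb R\times M$.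
   Context: $E=\mathbb R\times TM$ has adapted local coordinates $(t,x^i,u^i)$, $i=1,\dots,n$, where $(x^i)$ are local coordinates on $M$; summation over repeated indices is understood. A second-order differential equation field is a vector field on $E$ of the form $$\Gamma=\frac{\partial}{\partial t}+u^i\frac{\partial}{\partial x^i}+F^i\frac{\partial}{\partial u^i},$$ with $F^i(t,x,u)$ smooth. Put $$\Gamma^i_j:=-\tfrac12\frac{\partial F^i}{\partial u^j},\quad V_i:=\frac{\partial}{\partial u^i},\quad H_i:=\frac{\partial}{\partial x^i}-\Gamma^j_i\frac{\partial}{\partial u^j}.$$ Then $\{\Gamma,V_i,H_i\}$ is a local frame on $E$, with dual coframe $\{dt,\psi^i,\theta^i\}$, where $\theta^i=dx^i-u^idt$ and $\psi^i=du^i-F^idt+\Gamma^i_j\theta^j$. The following $(1,1)$ tensors on $E$ are globally defined: $$S=\theta^i\otimes V_i,\quad Q=\psi^i\otimes H_i,\quad P_\Gamma=dt\otimes\Gamma,\quad P_V=\psi^i\otimes V_i,\quad P_H=\theta^i\otimes H_i,$$ where $(\alpha\otimes Z)(X)=\alpha(X)Z$. A vector field on $E$ is vertical if it is tangent to the fibres of $E\to\mathbb R\times M$, i.e. locally of the form $X^iV_i$; a vertical lift from $\mathbb R\times M$ is one for which, locally, $X^i=X^i(t,x)$ does not depend on $u$. Torsion and curvature: $\hat T(X,Y)=\hat\nabla_XY-\hat\nabla_YX-[X,Y]$ and $R(X,Y)Z=\hat\nabla_X\hat\nabla_YZ-\hat\nabla_Y\hat\nabla_XZ-\hat\nabla_{[X,Y]}Z$.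 For a $(1,1)$ tensor $B$, $(\hat\nabla_XB)(Y)=\hat\nabla_X(B(Y))-B(\hat\nabla_XY)$. *)

(* Defs.v *)
From HB Require Import structures.
From mathcomp Require Import all_boot all_order all_algebra.
From mathcomp Require Import all_classical all_reals all_analysis.

Set Implicit Arguments.
Unset Strict Implicit.
Unset Printing Implicit Defensive.

Import Order.TTheory GRing.Theory Num.Theory numFieldNormedType.Exports.

Local Open Scope classical_set_scope.
Local Open Scope ring_scope.

(* Meant for an open set U: Frechet differentiable on U, with all directional
   derivatives of class C^(k-1). *)
Fixpoint Ck (R : realType) (V W : normedModType R) (k : nat) (U : set V)
    (f : V -> W) : Prop :=
  if k is k'.+1 then
    (forall x, U x -> differentiable f x) /\ forall v, Ck k' U ('D_v f)
  else forall x, U x -> {for x, continuous f}.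

Definition smooth_on (R : realType) (V W : normedModType R) (U : set V)
    (f : V -> W) : Prop := forall k, Ck k U f.

Section SmoothFunctions.
Context {R : realType} {V : normedModType R}.
Implicit Types (W : normedModType R) (U : set V).

Lemma near_eq_differentiable W (f g : V -> W) x :
  {near x, f =1 g} -> differentiable f x -> differentiable g x.
Proof.
move=> fg df.
have fgx : f x = g x by exact: (nbhs_singleton fg).
have E : g \o shift x = cst (g x) + 'd f x +o_ 0 id.
  apply/eqaddoP => e e0.
  have /eqaddoP/(_ e e0) H := diff_locally df.
  have fg0 : \forall y \near (0 : V), f (y + x) = g (y + x).
    have E := near_shift 0 x (fun y => f y = g y); rewrite subr0 in E.
    by have := fg; rewrite E.
  near=> y.
  have -> : (g \o shift x - (cst (g x) + 'd f x)) y =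
     (f \o shift x - (cst (f x) + 'd f x)) y.
    by rewrite !fctE /= fgx (near fg0 y).
  by near: y; exact: H.
apply/diff_locallyP.
have -> : 'd g x = 'd f x :> (V -> W) by apply: diff_unique => //; exact: diff_continuous.
by split => //; exact: diff_continuous.
Unshelve. all: by end_near. Qed.

Lemma open_near U x : open U -> U x -> \forall y \near x, U y.
Proof. by move=> oU Ux; exact: open_nbhs_nbhs. Qed.

Lemma near_eq_on W U (f g : V -> W) x : open U -> (forall y, U y -> f y = g y) ->
  U x -> {near x, f =1 g}.
Proof.
move=> oU fg Ux; have := open_near oU Ux.
by apply: filterS => y /fg.
Qed.

Lemma derive_eq_on W U (f g : V -> W) v : open U -> (forall y, U y -> f y = g y) ->
  forall x, U x -> 'D_v f x = 'D_v g x.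
Proof. by move=> oU fg x Ux; apply: near_eq_derive; exact: (near_eq_on oU fg). Qed.

Lemma Ck_ext W k U (f g : V -> W) : open U -> (forall x, U x -> f x = g x) ->
  Ck k U f -> Ck k U g.
Proof.
elim: k f g => [|k IH] f g oU fg /=.
  move=> cf x Ux; have fgx := near_eq_on oU fg Ux.
  rewrite /prop_for /continuous_at -(fg _ Ux); apply: cvg_trans (cf x Ux).
  apply: near_eq_cvg; exact: fgx.
move=> [df Df]; split=> [x Ux|v].
  exact: near_eq_differentiable (near_eq_on oU fg Ux) (df x Ux).
by apply: (IH ('D_v f)) => //; exact: derive_eq_on.
Qed.

Lemma CkS W k U (f : V -> W) : Ck k.+1 U f -> Ck k U f.
Proof.
elim: k f => [|k IH] f /= [df Df].
  by move=> x Ux; apply: differentiable_continuous; exact: df.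
by split=> // v; apply: IH; exact: Df.
Qed.

Lemma Ck_cst W k U (a : W) : Ck k U (cst a).
Proof.
elim: k a => [|k IH] a /=; first by move=> x _; exact: cst_continuous.
split=> [x _|v]; first exact: differentiable_cst.
have -> : 'D_v (cst a) = cst 0 by apply/funext => x; rewrite derive_cst.
exact: IH.
Qed.

Lemma Ck_add W k U (f g : V -> W) : open U ->
  Ck k U f -> Ck k U g -> Ck k U (f + g).
Proof.
move=> oU; elim: k f g => [|k IH] f g /=.
  by move=> cf cg x Ux; apply: continuousD; [exact: cf|exact: cg].
move=> [df Df] [dg Dg]; split=> [x Ux|v].
  by apply: differentiableD; [exact: df|exact: dg].
apply: (Ck_ext oU _ (IH _ _ (Df v) (Dg v))) => x Ux.
by rewrite deriveD //; apply: diff_derivable; [exact: df|exact: dg].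
Qed.

Lemma scale_is_bilinear W :
  bilinear_for
    (GRing.Scale.Law.clone _ _ *:%R _) (GRing.Scale.Law.clone _ _ *:%R _)
    ( *:%R : R -> W -> W).
Proof.
split=> [u'|u] a x y /=.
- by rewrite scalerDl scalerA.
- by rewrite scalerDr !scalerA mulrC.
Qed.

Lemma diff_scale W (h : V -> R) (f : V -> W) x :
  differentiable h x -> differentiable f x ->
  differentiable (fun z => h z *: f z) x /\
  forall v, 'D_v (fun z => h z *: f z) x = 'D_v h x *: f x + h x *: 'D_v f x.
Proof.
move=> dh df.
pose bM := bilinear_isBilinear.Build R R W W _ _ ( *:%R : R -> W -> W)
  (scale_is_bilinear W).
pose b : {bilinear R -> W -> W} := HB.pack ( *:%R : R -> W -> W) bM.
have cb : continuous (fun p : R * W => b p.1 p.2) by exact: scale_continuous.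
have db p : differentiable (fun p : R * W => b p.1 p.2) p.
  exact: differentiable_bilin.
have dp : differentiable (fun z => (h z, f z)) x by exact: differentiable_pair.
have E : (fun z => h z *: f z) = (fun p : R * W => b p.1 p.2) \o (fun z => (h z, f z)).
  by [].
have D : differentiable (fun z => h z *: f z) x.
  by rewrite E; apply: differentiable_comp => //; exact: db.
split=> // v; rewrite deriveE // E diff_comp //=.
have -> : 'd (fun p : R * W => b p.1 p.2) (h x, f x) =
    (fun q : R * W => b (h x) q.2 + b q.1 (f x)) :> (_ -> _).
  exact: (diff_bilin (h x, f x) cb).
by rewrite diff_pair //= !deriveE // addrC.
Qed.

Lemma Ck_scale W k U (h : V -> R) (f : V -> W) : open U ->
  Ck k U h -> Ck k U f -> Ck k U (fun z => h z *: f z).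
Proof.
move=> oU; elim: k h f => [|k IH] h f.
  move=> ch cf x Ux; rewrite /continuous_at.
  exact: (continuousZ (ch x Ux) (cf x Ux)).
move=> Ch Cf; have Ch' := CkS Ch; have Cf' := CkS Cf.
case: Ch => dh Dh; case: Cf => df Df; split=> [x Ux|v].
  by have [] := diff_scale (dh _ Ux) (df _ Ux).
apply: (Ck_ext oU _ (Ck_add oU (IH _ _ (Dh v) Cf') (IH _ _ Ch' (Df v)))) => x Ux.
by have [_ ->] := diff_scale (dh _ Ux) (df _ Ux).
Qed.

Lemma Ck_opp W k U (f : V -> W) : open U -> Ck k U f -> Ck k U (- f).
Proof.
move=> oU Cf; have := Ck_scale oU (Ck_cst k U (-1 : R)) Cf.
by apply: Ck_ext => // x _ /=; rewrite scaleN1r.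
Qed.

Lemma Ck_lin W W' k U (L : {linear W -> W'}) (f : V -> W) : continuous L ->
  open U -> Ck k U f -> Ck k U (L \o f).
Proof.
move=> cL oU; elim: k f => [|k IH] f /=.
  by move=> cf x Ux; apply: continuous_comp; [exact: cf|exact: cL].
move=> [df Df]; split=> [x Ux|v].
  by apply: differentiable_comp; [exact: df|exact: linear_differentiable].
apply: (Ck_ext oU _ (IH _ (Df v))) => x Ux /=.
have dL y : differentiable L y by exact: linear_differentiable.
have dLf : differentiable (L \o f) x by apply: differentiable_comp; [exact: df|].
have dLE : 'd L (f x) = L :> (W -> W') by exact: diff_lin.
rewrite (deriveE v (df x Ux)) (deriveE v dLf).
have -> : 'd (L \o f) x = 'd L (f x) \o 'd f x :> (V -> W').
  by apply: diff_comp => //; exact: df.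
by rewrite /comp dLE.
Qed.

Lemma Ck_id k U : Ck k U (@id V).
Proof.
case: k => [|k] /=; first by move=> x _.
split=> [x _|v]; first exact: ex_diff.
have -> : 'D_v (@id V) = cst v by apply/funext => x; rewrite derive_id.
exact: Ck_cst.
Qed.

End SmoothFunctions.

Section SecondDerivatives.
Context {R : realType} {V : normedModType R}.
Implicit Types (W : normedModType R) (U : set V).

Lemma is_derive_line W (f : V -> W) a v (t : R) : differentiable f (a + t *: v) ->
  is_derive t 1 (fun t => f (a + t *: v)) ('D_v f (a + t *: v)).
Proof.
move=> df.
have dl : is_diff t (fun t : R => a + t *: v) (fun t : R => t *: v).
  have -> : (fun t : R => a + t *: v) = cst a + ( *:%R ^~ v) by [].
  apply: is_diff_eq; exact: add0r.
have dfl : differentiable (f \o (fun t : R => a + t *: v)) t.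
  by apply: differentiable_comp => //.
apply: DeriveDef; first exact: diff_derivable.
rewrite [LHS]deriveE // (deriveE v df).
have -> : 'd (f \o (fun t : R => a + t *: v)) t =
   'd f (a + t *: v) \o 'd (fun t : R => a + t *: v) t :> (R -> W).
  by apply: diff_comp => //.
by rewrite /comp diff_val scale1r.
Qed.

Lemma second_difference U (f : V -> R) x v w (s : R) : 0 < s ->
  (forall y, U y -> differentiable f y) ->
  (forall y, U y -> differentiable ('D_v f) y) ->
  (forall c d : R, 0 <= c <= s -> 0 <= d <= s -> U (x + c *: v + d *: w)) ->
  exists c d : R, [/\ 0 <= c <= s, 0 <= d <= s &
    f (x + s *: v + s *: w) - f (x + s *: v) - (f (x + s *: w) - f x) =
    'D_w ('D_v f) (x + c *: v + d *: w) * s * s].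
Proof.
move=> s0 df Df inU.
have ss : 0 <= s <= s by rewrite (ltW s0) lexx.
have zs : (0 : R) <= 0 <= s by rewrite lexx (ltW s0).
pose phi (t : R) := f ((x + s *: w) + t *: v) - f (x + t *: v).
pose dphi (t : R) := 'D_v f ((x + s *: w) + t *: v) - 'D_v f (x + t *: v).
have U1 c : 0 <= c <= s -> U ((x + s *: w) + c *: v).
  by move=> /inU/(_ ss); rewrite addrAC.
have U2 c : 0 <= c <= s -> U (x + c *: v).
  by move=> /inU/(_ zs); rewrite scale0r addr0.
have Dphi c : 0 <= c <= s -> is_derive c 1 phi (dphi c).
  move=> cs; have h1 := is_derive_line (df _ (U1 c cs)).
  have h2 := is_derive_line (df _ (U2 c cs)).
  exact: is_deriveB.
have M1 : forall c : R, c \in `]0, s[%R -> is_derive c 1 phi (dphi c).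
  by move=> c; rewrite in_itv/= => /andP[/ltW c0 /ltW cs]; apply: Dphi; rewrite c0.
have M2 : {within `[0, s], continuous phi}.
  apply: derivable_within_continuous => c; rewrite in_itv/= => cs.
  by have [] := Dphi c cs.
have [c] := MVT s0 M1 M2.
rewrite in_itv/= => /andP[/ltW c0 /ltW cs] Ephi.
have c0s : 0 <= c <= s by rewrite c0.
clear M1 M2.
pose psi (t : R) := 'D_v f ((x + c *: v) + t *: w).
pose dpsi (t : R) := 'D_w ('D_v f) ((x + c *: v) + t *: w).
have Dpsi d : 0 <= d <= s -> is_derive d 1 psi (dpsi d).
  by move=> ds; exact: is_derive_line (Df _ (inU _ _ c0s ds)).
have M1 : forall d : R, d \in `]0, s[%R -> is_derive d 1 psi (dpsi d).
  by move=> d; rewrite in_itv/= => /andP[/ltW d0 /ltW ds]; apply: Dpsi; rewrite d0.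
have M2 : {within `[0, s], continuous psi}.
  apply: derivable_within_continuous => d; rewrite in_itv/= => ds.
  by have [] := Dpsi d ds.
have [d] := MVT s0 M1 M2.
rewrite in_itv/= => /andP[/ltW d0 /ltW ds] Epsi.
exists c, d; split=> //; first by rewrite d0.
move: Ephi; rewrite /phi /dphi !scale0r !addr0 subr0 => Ephi.
move: Epsi; rewrite /psi /dpsi !scale0r !addr0 subr0 => Epsi.
rewrite -Epsi [x + s *: v + s *: w]addrAC Ephi addrAC.
by [].
Qed.

Lemma near_parallelogram (P : set V) x v w : (\forall y \near x, P y) ->
  \forall s \near 0^'+, forall c d : R, 0 <= c <= s -> 0 <= d <= s ->
    P (x + c *: v + d *: w).
Proof.
move=> /nbhs_ballP[e /= e0 Pe].
have N0 : 0 < `|v| + `|w| + 1 by rewrite ltr_wpDl // addr_ge0.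
near=> s => c d /andP[c0 cs] /andP[d0 ds].
have s0 : 0 < s by near: s; exact: nbhs_right_gt.
apply: Pe; rewrite -ball_normE /= opprD opprD !addrA subrr add0r.
rewrite -opprD normrN (le_lt_trans (ler_normD _ _))// !normrZ.
rewrite (ger0_norm c0) (ger0_norm d0).
apply: (@le_lt_trans _ _ (s * (`|v| + `|w|))).
  by rewrite mulrDr lerD // ler_wpM2r.
apply: (@lt_trans _ _ (s * (`|v| + `|w| + 1))).
  by rewrite ltr_pM2l // ltrDl.
rewrite -ltr_pdivlMr //.
near: s; apply: nbhs_right_lt; exact: divr_gt0.
Unshelve. all: by end_near. Qed.

Lemma ler_dist_half (e a b p q : R) : `|a - p| <= e / 2 ->
  `|b - q| <= e / 2 -> p = q -> `|b - a| <= e.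
Proof.
move=> ap bq pq; rewrite [leRHS]splitr; apply: le_trans (lerD bq ap).
by rewrite pq (distrC a); exact: ler_distD.
Qed.

Lemma derive_sym U (f : V -> R) x v w : open U -> Ck 2 U f -> U x ->
  'D_v ('D_w f) x = 'D_w ('D_v f) x.
Proof.
move=> oU [df Df] Ux.
have dDf u y : U y -> differentiable ('D_u f) y by have [+ _] := Df u; apply.
have cDD u u' : {for x, continuous ('D_u ('D_u' f))}.
  by have [_ /(_ u)] := Df u'; apply.
apply/eqP; rewrite -subr_eq0 -normr_le0; apply/ler_addgt0Pl => e e0; rewrite addr0.
have e2 : 0 < e / 2 by rewrite divr_gt0.
have [/cvgrPdist_le/(_ _ e2) n1 /cvgrPdist_le/(_ _ e2) n2] := (cDD v w, cDD w v).
have nU := open_near oU Ux.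
have H1 := near_parallelogram v w nU.
have H2 := near_parallelogram w v nU.
have H3 := near_parallelogram v w n2.
have H4 := near_parallelogram w v n1.
have s_gt0 : \forall s \near (0 : R)^'+, 0 < s by exact: nbhs_right_gt.
have [s [s0 [{}H1 [{}H2 [{}H3 {}H4]]]]] :=
  filter_ex (filterI s_gt0 (filterI H1 (filterI H2 (filterI H3 H4)))).
have [c [d [cs ds E1]]] := second_difference s0 df (dDf v) H1.
have [c' [d' [cs' ds' E2]]] := second_difference s0 df (dDf w) H2.
have E : 'D_w ('D_v f) (x + c *: v + d *: w) = 'D_v ('D_w f) (x + c' *: w + d' *: v).
  have sn0 : s != 0 by rewrite gt_eqF.
  have aux (p q r t : R) : p - q - (r - t) = p - r - (q - t).
    by rewrite !opprB !addrA [LHS]addrAC [RHS]addrAC [p - q - r]addrAC.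
  have EE : 'D_w ('D_v f) (x + c *: v + d *: w) * s * s =
      'D_v ('D_w f) (x + c' *: w + d' *: v) * s * s.
    by apply: etrans (esym E1) (etrans _ E2); rewrite aux (addrAC x (s *: v)).
  exact: (mulIf sn0 (mulIf sn0 EE)).
exact: ler_dist_half (H3 _ _ cs ds) (H4 _ _ cs' ds') E.
Unshelve. all: by end_near. Qed.

Definition coordinatized (I : finType) (L : I -> {linear V -> R}) (b : I -> V) :=
  (forall i, continuous (L i)) /\ forall v, v = \sum_i L i v *: b i.

Section FiniteDim.
Variables (I : finType) (L : I -> {linear V -> R}) (b : I -> V).
Hypothesis Lb : coordinatized L b.

Lemma derive_coord W (g : V -> W) x v : differentiable g x ->
  'D_v g x = \sum_i L i v *: 'D_(b i) g x.
Proof.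
move=> dg; rewrite deriveE // {1}(Lb.2 v) linear_sum.
by apply: eq_bigr => i _; rewrite linearZ /= deriveE.
Qed.

Lemma Ck_sumT W k U (f : I -> V -> W) : open U ->
  (forall i, Ck k U (f i)) -> Ck k U (fun z => \sum_i f i z).
Proof.
move=> oU Cf.
have -> : (fun z => \sum_i f i z) = \sum_i f i.
  by apply/funext => z; rewrite fct_sumE.
elim/big_ind : _ => //; last by move=> ? ?; exact: Ck_add.
exact: Ck_cst.
Qed.

Lemma Ck_along W k U (g : V -> W) (c : V -> V) : open U ->
  Ck k.+1 U g -> Ck k U c -> Ck k U (fun y => 'D_(c y) g y).
Proof.
move=> oU [dg Dg] Cc.
apply: (Ck_ext oU _ (Ck_sumT (f := fun i y => L i (c y) *: 'D_(b i) g y) oU _)).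
  by move=> y Uy; rewrite -derive_coord //; exact: dg.
move=> i; apply: Ck_scale (Dg (b i)) => //.
exact: (Ck_lin (Lb.1 i) oU Cc).
Qed.

Lemma derive_lin W W' (M : {linear W -> W'}) (c : V -> W) x v : continuous M ->
  differentiable c x -> 'D_v (M \o c) x = M ('D_v c x).
Proof.
move=> cM dc.
have dM : differentiable M (c x) by exact: linear_differentiable.
have dMc : differentiable (M \o c) x by exact: differentiable_comp.
have dLE : 'd M (c x) = M :> (W -> W') by exact: diff_lin.
rewrite (deriveE v dc) (deriveE v dMc).
have -> : 'd (M \o c) x = 'd M (c x) \o 'd c x :> (V -> W') by exact: diff_comp.
by rewrite /comp dLE.
Qed.

Lemma derive_sumT W (f : I -> V -> W) x v : (forall i, differentiable (f i) x) ->
  'D_v (fun z => \sum_i f i z) x = \sum_i 'D_v (f i) x.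
Proof.
move=> df.
have -> : (fun z => \sum_i f i z) = \sum_i f i.
  by apply/funext => z; rewrite fct_sumE.
suff [_ ->] : differentiable (\sum_i f i) x /\
  'D_v (\sum_i f i) x = \sum_i 'D_v (f i) x by [].
elim/big_ind2 : _ => //.
  by split; [exact: differentiable_cst | exact: derive_cst].
move=> f1 s1 f2 s2 [d1 E1] [d2 E2]; split; first exact: differentiableD.
by rewrite deriveD ?E1 ?E2 //; exact: diff_derivable.
Qed.

Lemma derive_along U (g : V -> R) (c : V -> V) x w : open U -> U x ->
  Ck 2 U g -> (forall y, U y -> differentiable c y) ->
  'D_w (fun y => 'D_(c y) g y) x = 'D_('D_w c x) g x + 'D_w ('D_(c x) g) x.
Proof.
move=> oU Ux [dg Dg] dc.
have dDg u y : U y -> differentiable ('D_u g) y by have [+ _] := Dg u; apply.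
have dLc i : differentiable (L i \o c) x.
  by apply: differentiable_comp; [exact: dc|exact: linear_differentiable (Lb.1 i)].
rewrite (derive_eq_on (U := U) (g := fun y => \sum_i (L i \o c) y *: 'D_(b i) g y)) //;
  last by move=> y Uy; rewrite (derive_coord _ (dg y Uy)).
rewrite derive_sumT; last first.
  by move=> i; have [] := diff_scale (dLc i) (dDg (b i) _ Ux).
rewrite [X in _ + X](derive_eq_on (U := U)
    (g := fun y => \sum_i (cst (L i (c x)) y) *: 'D_(b i) g y)) //;
  last by move=> y Uy; rewrite (derive_coord _ (dg y Uy)).
rewrite derive_sumT; last first.
  by move=> i; have [] := diff_scale (differentiable_cst (L i (c x)) x) (dDg (b i) _ Ux).
rewrite (derive_coord _ (dg _ Ux)) -big_split /=; apply: eq_bigr => i _.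
have [_ ->] := diff_scale (dLc i) (dDg (b i) _ Ux).
have [_ ->] := diff_scale (differentiable_cst (L i (c x)) x) (dDg (b i) _ Ux).
rewrite derive_cst scale0r add0r; congr (_ *: _ + _).
by rewrite (derive_lin _ (Lb.1 i) (dc _ Ux)).
Qed.

Lemma derive_bracket U (g : V -> R) (c d : V -> V) x : open U -> U x ->
  Ck 2 U g -> (forall y, U y -> differentiable c y) ->
  (forall y, U y -> differentiable d y) ->
  'D_(c x) (fun y => 'D_(d y) g y) x - 'D_(d x) (fun y => 'D_(c y) g y) x =
  'D_('D_(c x) d x - 'D_(d x) c x) g x.
Proof.
move=> oU Ux Cg dc dd.
have dg : differentiable g x by case: Cg => + _; apply.
have E1 := derive_along (c x) oU Ux Cg dd.
have E2 := derive_along (d x) oU Ux Cg dc.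
have E3 := derive_sym (c x) (d x) oU Cg Ux.
have E4 : 'D_('D_(c x) d x - 'D_(d x) c x) g x =
    'D_('D_(c x) d x) g x - 'D_('D_(d x) c x) g x.
  by rewrite !(deriveE _ dg) linearB.
have key (p q r s t u : R) : p = r + t -> q = s + u -> t = u -> p - q = r - s.
  by move=> -> -> ->; rewrite opprD addrACA subrr addr0.
exact: etrans (key _ _ _ _ _ _ E1 E2 E3) (esym E4).
Qed.

End FiniteDim.
End SecondDerivatives.

Lemma smooth_cst (R : realType) (V W : normedModType R) (U : set V) (a : W) :
  smooth_on U (cst a).
Proof. by move=> k; exact: Ck_cst. Qed.

Lemma smooth_differentiable (R : realType) (V W : normedModType R) (U : set V)
    (f : V -> W) x : smooth_on U f -> U x -> differentiable f x.
Proof. by move=> /(_ 1%N)[df _]; exact: df. Qed.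

Lemma smoothD (R : realType) (V W : normedModType R) (U : set V)
    (f g : V -> W) : open U -> smooth_on U f -> smooth_on U g ->
  smooth_on U (fun y => f y + g y).
Proof. by move=> oU sf sg k; exact: Ck_add. Qed.

Lemma smoothZ (R : realType) (V W : normedModType R) (U : set V) (h : V -> R)
    (f : V -> W) : open U -> smooth_on U h -> smooth_on U f ->
  smooth_on U (fun y => h y *: f y).
Proof. by move=> oU sh sf k; exact: Ck_scale. Qed.

Lemma smoothN (R : realType) (V W : normedModType R) (U : set V)
    (f : V -> W) : open U -> smooth_on U f -> smooth_on U (fun y => - f y).
Proof. by move=> oU sf k; exact: Ck_opp. Qed.

Record smooth_manifold (R : realType) (n : nat) := SmoothManifold {
  carrier :> topologicalType;
  carrier_hausdorff : hausdorff_space carrier;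
  carrier_second_countable : @second_countable carrier;
  chart : Type;
  chart_dom : chart -> set carrier;
  chart_map : chart -> carrier -> 'rV[R]_n;
  chart_inv : chart -> 'rV[R]_n -> carrier;
  chart_cod := fun a => chart_map a @` chart_dom a;
  chart_cover : forall m, exists a, chart_dom a m;
  chart_dom_open : forall a, open (chart_dom a);
  chart_cod_open : forall a, open (chart_cod a);
  chart_mapK : forall a m, chart_dom a m -> chart_inv a (chart_map a m) = m;
  chart_map_continuous : forall a m, chart_dom a m ->
    {for m, continuous (chart_map a)};
  chart_inv_continuous : forall a x, chart_cod a x ->
    {for x, continuous (chart_inv a)};
  chart_transition : forall a b,
    smooth_on (chart_map a @` (chart_dom a `&` chart_dom b))
      (chart_map b \o chart_inv a) }.

Arguments chart_dom {R n s}.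
Arguments chart_map {R n s}.
Arguments chart_inv {R n s}.
Arguments chart_cod {R n s}.

(* A tangent vector at [foot] is given by its components in every chart around
   [foot], related by the Jacobians of the transition maps; the components in
   the other charts carry no information and are set to 0. *)
Record tangent_bundle (R : realType) (n : nat) (M : smooth_manifold R n) :=
  TangentVector {
  foot : M;
  velocity : chart M -> 'rV[R]_n;
  velocity_out : forall a, ~ chart_dom a foot -> velocity a = 0;
  velocity_transition : forall a b, chart_dom a foot -> chart_dom b foot ->
    velocity b =
      'D_(velocity a) (chart_map b \o chart_inv a) (chart_map a foot) }.

Definition evolution_space (R : realType) (n : nat) (M : smooth_manifold R n) :
  Type := (R * tangent_bundle M)%type.

(* Values ((t, x), u) of the adapted coordinates. *)
Definition coords (R : realType) (n : nat) : normedModType R :=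
  (R * 'rV[R]_n * 'rV[R]_n)%type.

Section Coords.
Context {R : realType} {n : nat}.
Implicit Types y : coords R n.

Definition d_t : coords R n := (1, 0, 0).
Definition d_x (i : 'I_n) : coords R n := (0, delta_mx 0 i, 0).
Definition d_u (i : 'I_n) : coords R n := (0, 0, delta_mx 0 i).

Fact coord_t_linear : linear (fun y => y.1.1). Proof. by []. Qed.
Fact coord_x_linear (i : 'I_n) : linear (fun y => y.1.2 0 i).
Proof. by move=> a u v /=; rewrite !mxE. Qed.
Fact coord_u_linear (i : 'I_n) : linear (fun y => y.2 0 i).
Proof. by move=> a u v /=; rewrite !mxE. Qed.

Definition coord_lin (k : unit + 'I_n + 'I_n) : {linear coords R n -> R} :=
  match k with
  | inl (inl _) => HB.pack (fun y => y.1.1)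
      (GRing.isLinear.Build R (coords R n) R _ _ coord_t_linear)
  | inl (inr i) => HB.pack (fun y => y.1.2 0 i)
      (GRing.isLinear.Build R (coords R n) R _ _ (coord_x_linear i))
  | inr i => HB.pack (fun y => y.2 0 i)
      (GRing.isLinear.Build R (coords R n) R _ _ (coord_u_linear i))
  end.

Definition coord_basis (k : unit + 'I_n + 'I_n) : coords R n :=
  match k with inl (inl _) => d_t | inl (inr i) => d_x i | inr i => d_u i end.

Lemma coord_x_continuous : continuous (fun y => y.1.2).
Proof.
move=> y; apply: (@continuous_comp _ _ _ fst snd); first exact: cvg_fst.
exact: cvg_snd.
Qed.

Lemma coords_coordinatized : coordinatized coord_lin coord_basis.
Proof.
split=> [[[[]|i]|i]|v] /=.
- move=> y; apply: (@continuous_comp _ _ _ fst fst); exact: cvg_fst.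
- move=> y; exact: (@continuous_comp _ _ _ (fun y => y.1.2)
    (fun x : 'M[R]_(1, n) => x 0 i) y (@coord_x_continuous y)
    (@coord_continuous R 1 n 0 i _)).
- move=> y; apply: (@continuous_comp _ _ _ snd (fun x : 'M[R]_(1, n) => x 0 i)).
    exact: cvg_snd.
  exact: coord_continuous.
case: v => [[t x] u]; rewrite !big_sumType /= (big_pred1 tt); last by case.
have -> : \sum_i x 0 i *: d_x i = (0, x, 0).
  rewrite {2}[x]row_sum_delta.
  rewrite [RHS](big_morph (fun z => (0, z, 0) : coords R n) (id1 := 0) (op1 := +%R)) //.
    by apply: eq_bigr => i _; congr (_, _, _); rewrite ?scaler0 ?mulr0.
  by move=> z z'; congr (_, _, _); rewrite addr0.
have -> : \sum_i u 0 i *: d_u i = (0, 0, u).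
  rewrite {2}[u]row_sum_delta.
  rewrite [RHS](big_morph (fun z => (0, 0, z) : coords R n) (id1 := 0) (op1 := +%R)) //.
    by apply: eq_bigr => i _; congr (_, _, _); rewrite ?scaler0 ?mulr0.
  by move=> z z'; congr (_, _, _); rewrite addr0.
congr (_, _, _); rewrite /= ?scaler0 ?addr0 ?add0r //.
by rewrite [RHS]mulr1.
Qed.
End Coords.

Section EvolutionSpace.
Context {R : realType} {n : nat} (M : smooth_manifold R n).
Local Notation E := (evolution_space M).

Definition adapted_dom (a : chart M) : set E :=
  [set e | chart_dom a (foot e.2)].

Definition adapted_map (a : chart M) (e : E) : coords R n :=
  (e.1, chart_map a (foot e.2), velocity e.2 a).

Definition adapted_cod (a : chart M) : set (coords R n) :=
  [set y | chart_cod a y.1.2].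

Lemma adapted_cod_open a : open (adapted_cod a).
Proof.
apply: (@open_comp _ _ (fun y : coords R n => y.1.2)).
  by move=> y _; exact: coord_x_continuous.
exact: chart_cod_open.
Qed.

Lemma adapted_map_cod a e : adapted_dom a e -> adapted_cod a (adapted_map a e).
Proof. by move=> ae; exists (foot e.2). Qed.

(* g is the expression of f in the adapted coordinates of the chart a *)
Definition local_expr (a : chart M) (f : E -> R) (g : coords R n -> R) :=
  smooth_on (adapted_cod a) g /\
  forall e, adapted_dom a e -> f e = g (adapted_map a e).

Definition smooth_fun : {pred E -> R} :=
  fun f => `[< forall a, exists g, local_expr a f g >].

Record Cinf := SmoothFun { cinf_fun :> E -> R; _ : cinf_fun \in smooth_fun }.
HB.instance Definition _ := [isSub for cinf_fun].
HB.instance Definition _ := [Choice of Cinf by <:].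

Lemma smooth_funP f : reflect (forall a, exists g, local_expr a f g)
  (f \in smooth_fun).
Proof. exact: asboolP. Qed.

Lemma smooth_fun_subring_closed : subring_closed smooth_fun.
Proof.
have oU := adapted_cod_open.
split=> [|f h /smooth_funP sf /smooth_funP sh|f h /smooth_funP sf /smooth_funP sh];
  apply/smooth_funP => a.
- by exists (cst 1); split=> //; exact: smooth_cst.
- have [[g [sg fg]] [k [sk hk]]] := (sf a, sh a).
  exists (fun y => g y - k y); split; first exact: smoothD (smoothN _ _).
  by move=> e ae; rewrite -fg // -hk.
- have [[g [sg fg]] [k [sk hk]]] := (sf a, sh a).
  exists (fun y => g y *: k y); split; first exact: smoothZ.
  by move=> e ae; rewrite -[RHS]/(_ * _) -fg // -hk.
Qed.
HB.instance Definition _ :=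
  GRing.isSubringClosed.Build (E -> R) smooth_fun smooth_fun_subring_closed.
HB.instance Definition _ :=
  GRing.SubChoice_isSubComPzRing.Build _ _ Cinf (subringClosedP smooth_fun).

Lemma cinfP (f h : Cinf) : (forall e, f e = h e) -> f = h.
Proof. by move=> fh; apply/val_inj/funext. Qed.

Lemma cinf_expr (f : Cinf) a : exists g, local_expr a f g.
Proof. by have /smooth_funP := valP f; apply. Qed.

(* X = c^k d/dy^k in the adapted coordinates y of the chart a, the right-hand
   side being the directional derivative along c *)
Definition in_chart (a : chart M) (X : Cinf -> Cinf)
    (c : coords R n -> coords R n) :=
  smooth_on (adapted_cod a) c /\
  forall (f : Cinf) g, local_expr a f g ->
  forall e, adapted_dom a e ->
    X f e = 'D_(c (adapted_map a e)) g (adapted_map a e).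

(* Vector fields are operators on smooth functions; the local form
   X = c^k d/dy^k with smooth c^k makes every such operator a derivation. *)
Record vfield := VField {
  vf_op :> Cinf -> Cinf;
  vf_chart : forall a, exists c, in_chart a vf_op c }.

Lemma vfieldP (X Y : vfield) : (forall f e, X f e = Y f e) -> X = Y.
Proof.
case: X Y => [X hX] [Y hY] /= XY.
have E0 : X = Y by apply/funext => f; apply: cinfP.
by rewrite E0 in hX *; congr VField; exact: Prop_irrelevance.
Qed.

Lemma local_expr_differentiable a f g e :
  local_expr a f g -> adapted_dom a e -> differentiable g (adapted_map a e).
Proof.
by move=> [sg _] ae; apply: smooth_differentiable sg _; exact: adapted_map_cod.
Qed.

Fact vf_zero_chart a : exists c, in_chart a (fun=> 0) c.
Proof.
exists (cst 0); split; first exact: smooth_cst.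
by move=> f g fg e ae; rewrite derive0.
Qed.

Fact vf_opp_chart (X : vfield) a : exists c, in_chart a (fun f => - X f) c.
Proof.
have [c [sc Xc]] := vf_chart X a.
exists (fun y => - c y); split; first exact: smoothN (@adapted_cod_open a) _.
move=> f g fg e ae; have dg := local_expr_differentiable fg ae.
by rewrite deriveE // linearN /= -deriveE // -(Xc f g).
Qed.

Fact vf_add_chart (X Y : vfield) a : exists c, in_chart a (fun f => X f + Y f) c.
Proof.
have [[c [sc Xc]] [d [sd Yd]]] := (vf_chart X a, vf_chart Y a).
exists (fun y => c y + d y); split; first exact: smoothD (@adapted_cod_open a) _ _.
move=> f g fg e ae; have dg := local_expr_differentiable fg ae.
by rewrite deriveE // linearD /= -!deriveE // -(Xc f g) // -(Yd f g).
Qed.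

Fact vf_scale_chart (h : Cinf) (X : vfield) a :
  exists c, in_chart a (fun f => h * X f) c.
Proof.
have [[c [sc Xc]] [k [sk hk]]] := (vf_chart X a, cinf_expr h a).
exists (fun y => k y *: c y); split; first exact: smoothZ (@adapted_cod_open a) _ _.
move=> f g fg e ae; have dg := local_expr_differentiable fg ae.
by rewrite deriveE // linearZ /= -deriveE // -(Xc f g) // -hk.
Qed.

Fact vf_bracket_chart (X Y : vfield) a :
  exists c, in_chart a (fun f => X (Y f) - Y (X f)) c.
Proof.
have oU := @adapted_cod_open a.
have [[c [sc Xc]] [d [sd Yd]]] := (vf_chart X a, vf_chart Y a).
have expr_op (Z : vfield) b (f : Cinf) g : in_chart a Z b ->
    local_expr a f g -> local_expr a (Z f) (fun y => 'D_(b y) g y).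
  move=> [sb Zb] [sg fg]; split; last by move=> e ae; exact: Zb.
  by move=> k; exact: (Ck_along coords_coordinatized oU (sg k.+1) (sb k)).
have s1 : smooth_on (adapted_cod a) (fun y => 'D_(c y) d y).
  by move=> k; exact: (Ck_along coords_coordinatized oU (sd k.+1) (sc k)).
have s2 : smooth_on (adapted_cod a) (fun y => 'D_(d y) c y).
  by move=> k; exact: (Ck_along coords_coordinatized oU (sc k.+1) (sd k)).
exists (fun y => 'D_(c y) d y - 'D_(d y) c y).
split; first exact: (smoothD oU s1 (smoothN oU s2)).
move=> f g fg e ae; have aU := adapted_map_cod ae.
have B := derive_bracket coords_coordinatized oU aU (fg.1 2%N)
  (fun y => smooth_differentiable sc) (fun y => smooth_differentiable sd).
have E1 := Xc _ _ (expr_op Y d f g (conj sd Yd) fg) e ae.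
have E2 := Yd _ _ (expr_op X c f g (conj sc Xc) fg) e ae.
by apply: etrans B; rewrite -E1 -E2.
Qed.

HB.instance Definition _ := gen_eqMixin vfield.
HB.instance Definition _ := gen_choiceMixin vfield.

Definition vf_zero := VField vf_zero_chart.
Definition vf_opp X := VField (vf_opp_chart X).
Definition vf_add X Y := VField (vf_add_chart X Y).
Definition vf_scale h X := VField (vf_scale_chart h X).

Fact vf_addA : associative vf_add.
Proof. by move=> X Y Z; apply: vfieldP => f e /=; rewrite addrA. Qed.
Fact vf_addC : commutative vf_add.
Proof. by move=> X Y; apply: vfieldP => f e /=; rewrite addrC. Qed.
Fact vf_add0 : left_id vf_zero vf_add.
Proof. by move=> X; apply: vfieldP => f e /=; rewrite add0r. Qed.
Fact vf_addN : left_inverse vf_zero vf_opp vf_add.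
Proof. by move=> X; apply: vfieldP => f e /=; rewrite addNr. Qed.
HB.instance Definition _ :=
  GRing.isZmodule.Build vfield vf_addA vf_addC vf_add0 vf_addN.

Fact vf_scaleA f h X : vf_scale f (vf_scale h X) = vf_scale (f * h) X.
Proof. by apply: vfieldP => k e /=; rewrite mulrA. Qed.
Fact vf_scale1 : left_id 1 vf_scale.
Proof. by move=> X; apply: vfieldP => k e /=; rewrite mul1r. Qed.
Fact vf_scaleDr : right_distributive vf_scale +%R.
Proof. by move=> f X Y; apply: vfieldP => k e /=; rewrite mulrDr. Qed.
Fact vf_scaleDl X : {morph vf_scale^~ X : f h / f + h}.
Proof. by move=> f h; apply: vfieldP => k e /=; rewrite mulrDl. Qed.
HB.instance Definition _ := GRing.Zmodule_isLmodule.Build Cinf vfield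
  vf_scaleA vf_scale1 vf_scaleDr vf_scaleDl.

Definition bracket (X Y : vfield) := VField (vf_bracket_chart X Y).

Fact time_smooth : (fun e : E => e.1) \in smooth_fun.
Proof.
apply/smooth_funP => a; exists (coord_lin (inl (inl tt))); split=> // k.
have cL := (@coords_coordinatized R n).1 (inl (inl tt)).
exact: (Ck_lin cL (@adapted_cod_open a) (Ck_id k _)).
Qed.
Definition time : Cinf := SmoothFun time_smooth.

Definition dt (Y : vfield) : Cinf := Y time.

End EvolutionSpace.

Section Sode.
Context {R : realType} {n : nat} {M : smooth_manifold R n}.
Implicit Types (F : coords R n -> 'rV[R]_n) (y v : coords R n).

(* Below, [F] is the forcing term of the local expression
   Gamma = d/dt + u^i d/dx^i + F^i d/du^i, at the point with coordinates
   y = ((t, x), u); the argument v is a tangent vector written in the basis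
   d_t, d_x, d_u. *)
Definition sode_vec F y : coords R n :=
  d_t + \sum_i y.2 0 i *: d_x i + \sum_i F y 0 i *: d_u i.

Definition Gamma_coef F (i j : 'I_n) y : R :=
  - 2^-1 * 'D_(d_u j) (fun z => F z 0 i) y.

Definition V_frame (i : 'I_n) : coords R n := d_u i.
Definition H_frame F (i : 'I_n) y : coords R n :=
  d_x i - \sum_j Gamma_coef F j i y *: d_u j.

Definition theta (i : 'I_n) y v : R := v.1.2 0 i - y.2 0 i * v.1.1.
Definition psi F (i : 'I_n) y v : R :=
  v.2 0 i - F y 0 i * v.1.1 + \sum_j Gamma_coef F i j y * theta j y v.

Definition S_expr y v : coords R n := \sum_i theta i y v *: V_frame i.
Definition Q_expr F y v : coords R n := \sum_i psi F i y v *: H_frame F i y.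
Definition PG_expr F y v : coords R n := v.1.1 *: sode_vec F y.
Definition PV_expr F y v : coords R n := \sum_i psi F i y v *: V_frame i.
Definition PH_expr F y v : coords R n := \sum_i theta i y v *: H_frame F i y.

Definition sode_coef (Gamma : vfield M) (a : chart M) F :=
  smooth_on (adapted_cod a) F /\ in_chart a Gamma (sode_vec F).

Definition is_sode (Gamma : vfield M) := forall a, exists F, sode_coef Gamma a F.

(* B is the (1,1) tensor on E given in adapted coordinates by [expr F] *)
Definition tensor_expr (Gamma : vfield M) (B : vfield M -> vfield M)
    (expr : (coords R n -> 'rV[R]_n) -> coords R n -> coords R n -> coords R n) :=
  forall a F, sode_coef Gamma a F ->
  forall (X : vfield M) c, in_chart a X c ->
    in_chart a (B X) (fun y => expr F y (c y)).

Record sode_tensors (Gamma : vfield M) := SodeTensors {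
  tS : vfield M -> vfield M;
  tQ : vfield M -> vfield M;
  tPG : vfield M -> vfield M;
  tPV : vfield M -> vfield M;
  tPH : vfield M -> vfield M;
  tS_expr : tensor_expr Gamma tS (fun _ => S_expr);
  tQ_expr : tensor_expr Gamma tQ Q_expr;
  tPG_expr : tensor_expr Gamma tPG PG_expr;
  tPV_expr : tensor_expr Gamma tPV PV_expr;
  tPH_expr : tensor_expr Gamma tPH PH_expr }.

Definition vertical (X : vfield M) := forall a,
  exists w : coords R n -> 'rV[R]_n,
    in_chart a X (fun y => \sum_i w y 0 i *: V_frame i).

(* [w] is a function of (t, x) = y.1 only *)
Definition vertical_lift (X : vfield M) := forall a,
  exists w : R * 'rV[R]_n -> 'rV[R]_n,
    in_chart a X (fun y => \sum_i w y.1 0 i *: V_frame i).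

Implicit Types nabla : vfield M -> vfield M -> vfield M.

Record linear_connection nabla : Prop := LinearConnection {
  connection_linear_l : forall (f : Cinf M) X Y Z,
    nabla (f *: X + Y) Z = f *: nabla X Z + nabla Y Z;
  connection_add_r : forall X Y Z,
    nabla X (Y + Z) = nabla X Y + nabla X Z;
  connection_leibniz : forall X (f : Cinf M) Y,
    nabla X (f *: Y) = X f *: Y + f *: nabla X Y }.

Definition nabla_tensor nabla (B : vfield M -> vfield M) X Y :=
  nabla X (B Y) - B (nabla X Y).

Definition nabla_dt nabla (X Y : vfield M) : Cinf M :=
  X (dt Y) - dt (nabla X Y).

Definition torsion nabla X Y := nabla X Y - nabla Y X - bracket X Y.

Definition curvature nabla X Y Z :=
  nabla X (nabla Y Z) - nabla Y (nabla X Z) - nabla (bracket X Y) Z.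

Section MassaPagani.
Context (Gamma : vfield M) (B : sode_tensors Gamma).
Local Notation S := (tS B).
Local Notation Q := (tQ B).
Local Notation P_V := (tPV B).
Local Notation P_H := (tPH B).

Definition massa_pagani (X Y : vfield M) : vfield M :=
  X (dt Y) *: Gamma + Q (bracket (P_H X) (S Y)) + S (bracket (P_V X) (Q Y))
  + P_H (bracket (X - P_H X) (P_H Y)) + P_V (bracket (X - P_V X) (P_V Y)).

Record massa_pagani_conditions nabla : Prop := MassaPaganiConditions {
  nabla_Gamma_eq0 : forall X, nabla X Gamma = 0;
  nabla_dt_eq0 : forall X Y, nabla_dt nabla X Y = 0;
  nabla_S_eq0 : forall X Y, nabla_tensor nabla S X Y = 0;
  nabla_Q_eq0 : forall X Y, nabla_tensor nabla Q X Y = 0;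
  torsion_H : forall X, P_H X = torsion nabla Gamma (S X);
  torsion_V : forall X, P_V X = S (torsion nabla Gamma X);
  curvature_Gamma_vertical : forall X, vertical X ->
    forall Z, curvature nabla Gamma X Z = 0;
  nabla_vertical_lift : forall X U, vertical X -> vertical_lift U ->
    nabla X U = 0 }.
End MassaPagani.
End Sode.

(* Main.v *)
Require Import Defs.
From HB Require Import structures.
From mathcomp Require Import all_boot all_order all_algebra.
From mathcomp Require Import all_classical all_reals all_analysis.
From mathcomp Require Import ring lra.

(* Existence.  Besides the algebra of S, Q and the projectors, only four facts
   need coordinates: the vertical distribution is involutive,
   P_H [Gamma, S X] = - P_H X, P_V [Gamma, S X] = S [Gamma, P_H X], and
   S [V, Q U] = 0 for V vertical and U a vertical lift.  With the Jacobi identity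
   for (Gamma, V, Z), where V and Z are vertical, they give
   P_V [V, Q Z] + P_V [Q V, Z] = S [Q V, Q Z]; in view of this identity,
   R(Gamma, V) Z is S applied to the Jacobi identity for (Gamma, V, Q Z).

   Uniqueness.  Since nabla commutes with S and Q and preserves Gamma and dt, it
   is determined by its values nabla_X Z on vertical Z.  The torsion gives
   nabla_Gamma.  For X vertical, the difference of two such connections is
   C^oo-linear in Z and vanishes on vertical lifts, which span the vertical
   fields after multiplication by a squared bump function.  As
   P_H W = P_V [Gamma, S W] - [Gamma, S W], the equation R(Gamma, S W) = 0 then
   determines nabla on horizontal X. *)

Set Implicit Arguments.
Unset Strict Implicit.
Unset Printing Implicit Defensive.

Import Order.TTheory GRing.Theory Num.Theory numFieldNormedType.Exports.

Local Open Scope classical_set_scope.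
Local Open Scope ring_scope.

(** * Vector fields as derivations *)

Section VectorFields.
Context {R : realType} {n : nat} {M : smooth_manifold R n}.
Implicit Types (a : chart M) (f h : Cinf M) (X Y Z : vfield M)
  (c d : coords R n -> coords R n) (e : evolution_space M).

Lemma cinfDE f h e : (f + h) e = f e + h e. Proof. by []. Qed.
Lemma cinfME f h e : (f * h) e = f e * h e. Proof. by []. Qed.
Lemma cinfNE f e : (- f) e = - f e. Proof. by []. Qed.
Lemma cinf0E e : (0 : Cinf M) e = 0. Proof. by []. Qed.
Lemma cinf1E e : (1 : Cinf M) e = 1. Proof. by []. Qed.
Lemma vfDE X Y f : (X + Y) f = X f + Y f. Proof. by []. Qed.
Lemma vfNE X f : (- X) f = - X f. Proof. by []. Qed.
Lemma vf0E f : (0 : vfield M) f = 0. Proof. by []. Qed.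
Lemma vfZE h X f : (h *: X) f = h * X f. Proof. by []. Qed.
Lemma bracketE X Y f : bracket X Y f = X (Y f) - Y (X f). Proof. by []. Qed.

Lemma adapted_chart_at e : exists a : chart M, adapted_dom a e.
Proof. exact: chart_cover. Qed.

Lemma in_chart_eq a X Y c d : in_chart a X c -> in_chart a Y d ->
  (forall y, adapted_cod a y -> c y = d y) ->
  forall f e, adapted_dom a e -> X f e = Y f e.
Proof.
move=> [_ Xc] [_ Yd] cd f e ae; have [g fg] := cinf_expr f a.
by rewrite (Xc _ _ fg) // (Yd _ _ fg) // cd //; exact: adapted_map_cod.
Qed.

(** A [vfield] is known only through its local forms. Additivity, and below the Leibniz rule, are
    inherited from the directional derivative in a chart around each point. *)
Lemma vfD X f h : X (f + h) = X f + X h.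
Proof.
apply: cinfP => e; have [a ae] := adapted_chart_at e.
have [c [_ Xc]] := vf_chart X a.
have [[g fg] [k hk]] := (cinf_expr f a, cinf_expr h a).
have fhgk : local_expr a (f + h : Cinf M) (fun y => g y + k y).
  split; first exact: smoothD (@adapted_cod_open _ _ _ a) fg.1 hk.1.
  by move=> e' ae'; rewrite ?cinfDE ?cinfME fg.2 // hk.2.
have [dg dk] := (local_expr_differentiable fg ae, local_expr_differentiable hk ae).
rewrite ?cinfDE ?cinfME (Xc _ _ fhgk) // (Xc _ _ fg) // (Xc _ _ hk) //.
by apply: deriveD; exact: diff_derivable.
Qed.

Lemma vfM X f h : X (f * h) = X f * h + f * X h.
Proof.
apply: cinfP => e; have [a ae] := adapted_chart_at e.
have [c [_ Xc]] := vf_chart X a.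
have [[g fg] [k hk]] := (cinf_expr f a, cinf_expr h a).
have fhgk : local_expr a (f * h : Cinf M) (fun y => g y *: k y).
  split; first exact: smoothZ (@adapted_cod_open _ _ _ a) fg.1 hk.1.
  by move=> e' ae'; rewrite ?cinfDE ?cinfME fg.2 // hk.2.
have [dg dk] := (local_expr_differentiable fg ae, local_expr_differentiable hk ae).
rewrite ?cinfDE ?cinfME (Xc _ _ fhgk) // (Xc _ _ fg) // (Xc _ _ hk) //.
have [_ ->] := diff_scale dg dk.
by rewrite (fg.2 _ ae) (hk.2 _ ae).
Qed.

Lemma vf1 X : X 1 = 0.
Proof. by have := vfM X 1 1; rewrite !(mulr1, mul1r) -[LHS]addr0 => /addrI. Qed.

Lemma vf0 X : X 0 = 0.
Proof. by have := vfD X 0 0; rewrite addr0 -[LHS]addr0 => /addrI. Qed.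

Lemma vfN X f : X (- f) = - X f.
Proof. by apply/eqP; rewrite -addr_eq0 -vfD addNr vf0. Qed.

(** These rules turn an identity between brackets into a polynomial identity between values of
    iterated derivatives at a point, which [ring] decides. *)
Definition evalE := (cinfDE, cinfME, cinfNE, cinf0E, cinf1E, vfDE, vfNE, vf0E,
  vfZE, bracketE, vfD, vfN, vfM, vf0, vf1).

Lemma bracketDl X Y Z : bracket (X + Y) Z = bracket X Z + bracket Y Z.
Proof. by apply: vfieldP => f e; rewrite !evalE; ring. Qed.

Lemma bracketDr X Y Z : bracket X (Y + Z) = bracket X Y + bracket X Z.
Proof. by apply: vfieldP => f e; rewrite !evalE; ring. Qed.

Lemma bracketZr X f Y : bracket X (f *: Y) = f *: bracket X Y + X f *: Y.
Proof. by apply: vfieldP => h e; rewrite !evalE; ring. Qed.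

Lemma bracketZl X f Y : bracket (f *: X) Y = f *: bracket X Y - Y f *: X.
Proof. by apply: vfieldP => h e; rewrite !evalE; ring. Qed.

Lemma bracket0l X : bracket 0 X = 0.
Proof. by apply: vfieldP => h e; rewrite !evalE; ring. Qed.

Lemma bracket0r X : bracket X 0 = 0.
Proof. by apply: vfieldP => h e; rewrite !evalE; ring. Qed.

Lemma bracketNl X Y : bracket (- X) Y = - bracket X Y.
Proof. by apply: vfieldP => h e; rewrite !evalE; ring. Qed.

Lemma bracketNr X Y : bracket X (- Y) = - bracket X Y.
Proof. by apply: vfieldP => h e; rewrite !evalE; ring. Qed.

Lemma jacobi X Y Z :
  bracket X (bracket Y Z) = bracket (bracket X Y) Z + bracket Y (bracket X Z).
Proof. by apply: vfieldP => h e; rewrite !evalE; ring. Qed.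

Lemma dt_bracket X Y : dt (bracket X Y) = X (dt Y) - Y (dt X).
Proof. by []. Qed.

(** [vf_bracket_chart] only asserts that components exist; the computations with S and Q need these
    explicit ones. Second-order terms cancel by symmetry of second derivatives, through
    [derive_bracket]. *)
Lemma in_chart_bracket a X Y c d : in_chart a X c -> in_chart a Y d ->
  in_chart a (bracket X Y) (fun y => 'D_(c y) d y - 'D_(d y) c y).
Proof.
move=> Xc Yd; have oU := @adapted_cod_open _ _ M a.
have C := @coords_coordinatized R n.
have expr_op Z b f g : in_chart a Z b ->
    local_expr a f g -> local_expr a (Z f) (fun y => 'D_(b y) g y).
  by move=> [sb Zb] [sg fg]; split=> [k|e]; [exact: (Ck_along C oU (sg _) (sb k)) | exact: Zb].
split=> [k|f g fg e ae].
  apply: (Ck_add oU); last apply: (Ck_opp oU).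
    exact: (Ck_along C oU (Yd.1 _) (Xc.1 _)).
  exact: (Ck_along C oU (Xc.1 _) (Yd.1 _)).
rewrite bracketE cinfDE cinfNE.
rewrite (Xc.2 _ _ (expr_op _ _ _ _ Yd fg)) // (Yd.2 _ _ (expr_op _ _ _ _ Xc fg)) //.
apply: (derive_bracket C oU (adapted_map_cod ae) (fg.1 2%N)) => y.
  exact: smooth_differentiable Xc.1.
exact: smooth_differentiable Yd.1.
Qed.
End VectorFields.

(** * Smooth functions and bump functions *)

Section SmoothComposition.
Context {R : realType} {V W Z : normedModType R}.
Implicit Types (k : nat) (U : set V).

Lemma Ck_sub k U U' (f : V -> W) : U `<=` U' -> Ck k U' f -> Ck k U f.
Proof.
move=> sUU; elim: k f => [|k IH] f /=; first by move=> cf x /sUU; exact: cf.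
move=> [df Df].
by split=> [x /sUU|v]; [exact: df|exact: IH (Df v)].
Qed.

Lemma Ck_local k U (f : V -> W) :
  (forall x, U x -> exists O, [/\ O x & Ck k O f]) -> Ck k U f.
Proof.
elim: k f => [|k IH] f loc /=.
  by move=> x /loc[N [Nx cf]]; exact: cf.
split; first by move=> x /loc[N [Nx [df _]]]; exact: df.
move=> v; apply: IH => x /loc[N [Nx [_ Df]]]; exists N; split=> //; exact: Df.
Qed.

Lemma derive_comp (f : V -> W) (g : W -> Z) x v :
  differentiable f x -> differentiable g (f x) ->
  'D_v (g \o f) x = 'D_('D_v f x) g (f x).
Proof.
move=> df dg; have dgf : differentiable (g \o f) x by exact: differentiable_comp.
rewrite (deriveE v dgf) (deriveE _ dg) (deriveE v df).
have -> : 'd (g \o f) x = 'd g (f x) \o 'd f x :> (V -> Z) by exact: diff_comp.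
by [].
Qed.

(** Induction on k by the chain rule. The direction ['D_v f x] moves with x, so it is expanded in
    the basis b; this leaves partial derivatives of g in fixed directions, to which the induction
    hypothesis applies. *)
Lemma Ck_comp (I : finType) (L : I -> {linear W -> R}) (b : I -> W)
    k U (U' : set W) (f : V -> W) (g : W -> Z) :
  coordinatized L b -> open U -> (forall x, U x -> U' (f x)) ->
  Ck k U f -> Ck k U' g -> Ck k U (g \o f).
Proof.
move=> Lb oU sUU; elim: k g => [|k IH] g.
  move=> cf cg x Ux; apply: continuous_comp; first exact: cf.
  exact: cg (sUU _ Ux).
move=> Cf Cg; have Cf' := CkS Cf.
case: Cf Cg => df Df [dg Dg]; split=> [x Ux|v].
  by apply: differentiable_comp; [exact: df | exact: dg (sUU _ Ux)].
apply: (Ck_ext oU _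
  (Ck_sumT (f := fun i x => L i ('D_v f x) *: ('D_(b i) g \o f) x) oU _)).
  move=> x Ux; rewrite (derive_comp v (df _ Ux) (dg _ (sUU _ Ux))).
  by rewrite -(derive_coord Lb _ (dg _ (sUU _ Ux))).
move=> i; apply: (Ck_scale oU _ (IH _ Cf' (Dg _))).
exact: (Ck_lin (Lb.1 i) oU (Df v)).
Qed.

Lemma Ck_prod (I : finType) k U (f : I -> V -> R) : open U ->
  (forall i, Ck k U (f i)) -> Ck k U (fun z => \prod_i f i z).
Proof.
move=> oU Cf.
suff Cr (r : seq I) : Ck k U (fun z => \prod_(i <- r) f i z) by exact: Cr.
elim: r => [|i r IH].
  have -> : (fun z => \prod_(i <- [::]) f i z) = cst 1.
    by apply/funext => z; rewrite big_nil.
  exact: Ck_cst.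
have -> : (fun z => \prod_(j <- i :: r) f j z) =
    (fun z => f i z *: \prod_(j <- r) f j z).
  by apply/funext => z; rewrite big_cons.
exact: Ck_scale.
Qed.
End SmoothComposition.

Section Coordinatized.
Context {R : realType}.

Definition row_coord n (i : 'I_n) : {linear 'rV[R]_n -> R} :=
  HB.pack (fun v : 'rV[R]_n => v 0 i)
    (GRing.isLinear.Build R 'rV[R]_n R _ (fun v : 'rV[R]_n => v 0 i)
      (fun a u v => etrans (mxE _ _ _ _) (congr1 (+%R^~ (v 0 i)) (mxE _ _ _ _)))).

Lemma row_coordinatized n :
  coordinatized (@row_coord n) (fun i => delta_mx 0 i : 'rV[R]_n).
Proof.
by split=> [i|v]; [exact: coord_continuous | exact: row_sum_delta].
Qed.

Lemma real_coordinatized :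
  coordinatized (fun _ : unit => idfun : {linear R -> R}) (fun=> 1).
Proof.
split=> [i|v]; first by move=> x; exact: cvg_id.
by rewrite (big_pred1 tt); [rewrite [RHS]mulr1 | case].
Qed.
End Coordinatized.

(** * The flat function exp(-1/s) and its derivatives *)

Section FlatFunction.
Context {R : realType}.
Implicit Types (s : R) (k n : nat).

(* s^-n exp(-1/s): these span a space closed under differentiation, so that
   smoothness follows by induction on the order. *)
Definition flat_exp n s : R := if 0 < s then s^-1 ^+ n * expR (- s^-1) else 0.

(** For s > 0 the exponential series gives exp(1/s) >= s^-(n+2) / (n+2)!. The quadratic bound is
    what makes the derivative at 0 exist and vanish. *)
Lemma flat_exp_bound n s : `|flat_exp n s| <= n.+2`!%:R * s ^+ 2.
Proof.
rewrite /flat_exp; case: ifPn => [s0|_]; last by rewrite normr0 mulr_ge0 ?sqr_ge0.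
have si0 : 0 < s^-1 by rewrite invr_gt0.
rewrite ger0_norm; last by rewrite mulr_ge0 ?expR_ge0 ?exprn_ge0 ?ltW.
rewrite expRN ler_pdivrMr ?expR_gt0 //.
have /(le_trans (ler_wpDl _ (lexx _)))-/(_ ler01) := expR_ge1Dxn n.+1 (ltW si0).
rewrite ler_pdivrMr ?ltr0n ?fact_gt0 // => H.
have -> : s^-1 ^+ n = s ^+ 2 * s^-1 ^+ n.+2.
  by rewrite -[n.+2]addn2 exprD mulrCA -exprMn mulfV ?gt_eqF // expr1n mulr1.
rewrite [leRHS](_ : _ = s ^+ 2 * (expR s^-1 * n.+2`!%:R)); last by ring.
by rewrite ler_pM2l // exprn_gt0.
Qed.

Lemma is_derive0_quadratic (f : R -> R) C : (forall s, `|f s| <= C * s ^+ 2) ->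
  is_derive (0 : R) (1 : R) f (0 : R).
Proof.
move=> fC; have f0 : f 0 = 0.
  by apply/eqP; rewrite -normr_le0 (le_trans (fC 0)) // expr0n mulr0.
have C0 : 0 <= C by have := fC 1; rewrite expr1n mulr1; exact: le_trans.
suff H : (fun h => h^-1 *: ((f \o shift 0) (h *: 1) - f 0)) @ 0^' --> (0 : R).
  by apply: DeriveDef; [apply/cvg_ex; exists 0 | exact: cvg_lim H].
apply/cvgrPdist_le => e e0; near=> h.
have h0 : h != 0 by near: h; exact: nbhs_dnbhs_neq.
rewrite sub0r normrN f0 subr0 /= addr0 [h *: 1]mulr1 normrM normfV.
rewrite ler_pdivrMl ?normr_gt0 // (le_trans (fC h)) //.
rewrite -real_normK ?num_real // expr2 mulrCA ler_pM2l ?normr_gt0 //.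
(* C may be 0, so C + 1 is used as the divisor of e. *)
apply: (@le_trans _ _ ((C + 1) * `|h|)); first by rewrite ler_wpM2r // lerDl.
rewrite mulrC -ler_pdivlMr ?ltr_wpDl //.
near: h; apply: dnbhs0_le; rewrite divr_gt0 // ltr_wpDl //.
Unshelve. all: by end_near. Qed.

Lemma is_derive_flat_exp n s :
  is_derive s 1 (flat_exp n) (flat_exp n.+2 s - n%:R * flat_exp n.+1 s).
Proof.
have [s0|s0|<-] := ltgtP 0 s.
- apply: (@near_eq_is_derive _ _ _ (fun t : R => t^-1 ^+ n * expR (- t^-1))).
    near=> t; rewrite /flat_exp ifT //; near: t; exact: lt_nbhsr.
  have sn0 : s != 0 by rewrite gt_eqF.
  have dV : is_derive s (1 : R) (fun t : R => t^-1) (- s^-1 ^+ 2).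
    apply: (is_derive_eq (is_deriveV sn0 (is_derive_id s (1 : R)))).
    by rewrite [LHS]mulr1 exprVn.
  have dX : is_derive s (1 : R) (fun t : R => t^-1 ^+ n)
      (n%:R * s^-1 ^+ n.-1 * - s^-1 ^+ 2).
    have -> : (fun t : R => t^-1 ^+ n) = (fun t : R => t^-1) ^+ n.
      by rewrite exprfctE.
    exact: (is_derive_eq (is_deriveX n dV)).
  have dE : is_derive s (1 : R) (fun t : R => expR (- t^-1)) (expR (- s^-1) * s^-1 ^+ 2).
    apply: (is_derive_eq (is_derive1_comp (is_derive_expR _) (is_deriveN dV))).
    by rewrite opprK.
  apply: (is_derive_eq (is_deriveM dX dE)).
  rewrite /flat_exp s0 -![_ *: _]/(_ * _).
  (* For n = 0 the exponent [n.-1] is truncated, but its coefficient is 0. *)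
  case: n {dX} => [|n] /=; first by rewrite !mulr0n; ring.
  move: (s^-1) => q; move: (expR _) => r; rewrite -natr1 !exprS; ring.
- apply: (@near_eq_is_derive _ _ _ (cst 0)).
    near=> t; rewrite /flat_exp ifF //; apply/negbTE; rewrite -leNgt ltW //.
    near: t; exact: lt_nbhsl.
  by rewrite /flat_exp ltNge (ltW s0) /= mulr0 subr0; exact: is_derive_cst.
- rewrite {2 3}/flat_exp ltxx mulr0 subr0; exact: is_derive0_quadratic (flat_exp_bound n).
Unshelve. all: by end_near. Qed.

Lemma Ck_flat_exp k n : Ck k setT (flat_exp n).
Proof.
elim: k n => [|k IH] n /=.
  move=> s _; apply/differentiable_continuous/derivable1_diffP.
  by have [] := is_derive_flat_exp n s.
have df m s : differentiable (flat_exp m) s.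
  by apply/derivable1_diffP; have [] := is_derive_flat_exp m s.
split=> [s _|v]; first exact: df.
apply: (Ck_ext openT _ (Ck_add openT (Ck_scale openT (Ck_cst k setT (v : R)) (IH n.+2))
  (Ck_scale openT (Ck_cst k setT (- (v * n%:R))) (IH n.+1)))) => s _.
have -> : 'D_v (flat_exp n) s = v * 'D_1 (flat_exp n) s.
  by rewrite !deriveE // -[X in 'd _ _ X]mulr1 -[v * 1]/(v *: (1 : R)) linearZ.
have [_ ->] := is_derive_flat_exp n s.
by rewrite -[LHS]/(v * _ + - (v * n%:R) * _); ring.
Qed.

End FlatFunction.

(** * Smooth bump functions on boxes of R^n *)

Section BoxBump.
Context {R : realType} {n : nat}.
Implicit Types (x p : 'rV[R]_n) (r : R).

(** For r > 0 it is nonzero exactly on the open cube of half-side r around p. Cubes are the balls of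
    the sup norm on row vectors, and their closures are compact as products of segments. *)
Definition box_bump p r x : R := \prod_i flat_exp 0 (r ^+ 2 - (x 0 i - p 0 i) ^+ 2).

Lemma Ck_box_bump k p r : Ck k setT (box_bump p r).
Proof.
apply: (Ck_prod openT) => i.
have Cxi : Ck k setT (fun x : 'rV[R]_n => x 0 i).
  exact: (Ck_lin ((@row_coordinatized R n).1 i) openT (Ck_id k setT)).
have Cx : Ck k setT (fun x : 'rV[R]_n => x 0 i - p 0 i).
  exact: (Ck_add openT Cxi (Ck_cst k setT (- p 0 i))).
have Cq : Ck k setT (fun x : 'rV[R]_n => r ^+ 2 - (x 0 i - p 0 i) ^+ 2).
  exact: (Ck_add openT (Ck_cst k setT (r ^+ 2)) (Ck_opp openT (Ck_scale openT Cx Cx))).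
exact: (Ck_comp (@real_coordinatized R) openT _ Cq (Ck_flat_exp k 0)).
Qed.

Lemma flat_exp_neq0 m (s : R) : (flat_exp m s != 0) = (0 < s).
Proof.
rewrite /flat_exp; case: ifPn => [s0|]; last by rewrite eqxx.
by rewrite mulf_neq0 ?expf_neq0 ?invr_eq0 ?gt_eqF ?expR_gt0.
Qed.

Lemma box_bump_center p r : 0 < r -> box_bump p r p != 0.
Proof.
move=> r0; apply/prodf_neq0 => i _.
by rewrite flat_exp_neq0 subrr expr0n subr0 exprn_gt0.
Qed.

Lemma box_bump_support p r x : 0 < r -> box_bump p r x != 0 ->
  forall i, `|x 0 i - p 0 i| <= r.
Proof.
move=> r0 /prodf_neq0 px i; have := px i isT.
rewrite flat_exp_neq0 subr_gt0 -real_normK ?num_real // => /ltW.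
by rewrite ler_sqr // nnegrE ltW.
Qed.

Lemma compact_box p r : compact [set x : 'rV[R]_n | forall i, `|x 0 i - p 0 i| <= r].
Proof.
have := @rV_compact R n (fun i => `[p 0 i - r, p 0 i + r]%classic)
  (fun i => @segment_compact R _ _).
congr compact; apply/seteqP; split=> x /= H i; have := H i.
  by rewrite /= in_itv /= -ler_distlC distrC.
by rewrite /= in_itv /= -ler_distlC distrC.
Qed.
End BoxBump.

(** * Bump functions in a chart and extension by zero *)

Section ChartBump.
Context {R : realType} {n : nat} {M : smooth_manifold R n}.
Implicit Types (a b : chart M) (m : M) (K : set 'rV[R]_n).

Lemma chart_cod_inv a x : chart_cod a x ->
  chart_dom a (chart_inv a x) /\ chart_map a (chart_inv a x) = x.
Proof. by move=> [m am <-]; rewrite chart_mapK. Qed.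

Definition compactly_supported_in a (chi : 'rV[R]_n -> R) :=
  exists K, [/\ compact K, K `<=` chart_cod a & forall x, chi x != 0 -> K x].

Lemma chart_bump a m : chart_dom a m -> exists chi : 'rV[R]_n -> R,
  [/\ smooth_on setT chi, chi (chart_map a m) != 0 & compactly_supported_in a chi].
Proof.
move=> am; have : nbhs (chart_map a m) (chart_cod a).
  by apply: open_nbhs_nbhs; split; [exact: chart_cod_open | exists m].
move=> /nbhs_ballP[e /= e0 He]; have e20 : 0 < e / 2 by rewrite divr_gt0.
(* The radius is halved so that the closed box still lies in the open ball of radius e, hence in the
   image of the chart. *)
exists (box_bump (chart_map a m) (e / 2)); split; first by move=> k; exact: Ck_box_bump.
  exact: box_bump_center.
exists [set x : 'rV[R]_n | forall i, `|x 0 i - chart_map a m 0 i| <= e / 2]; split.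
- exact: compact_box.
- move=> x Hx; apply: He; split=> // i j; rewrite ord1 -ball_normE /= distrC.
  by apply: le_lt_trans (Hx j) _; rewrite ltr_pdivrMr // ltr_pMr // ltr1n.
- by move=> x; exact: box_bump_support.
Qed.

(** Hausdorffness of M enters here: a compact image is closed, so a point outside the chart has a
    neighbourhood that avoids the support of the bump function. *)
Lemma closed_chart_inv a K : compact K -> K `<=` chart_cod a ->
  closed (chart_inv a @` K).
Proof.
move=> cK Ka; apply: compact_closed; first exact: carrier_hausdorff.
apply: continuous_compact cK; apply: continuous_in_subspaceT => x.
by rewrite inE => /Ka; exact: chart_inv_continuous.
Qed.

Lemma open_chart_preimage b (O : set M) : open O ->
  open [set y | chart_cod b y /\ O (chart_inv b y)].
Proof.
move=> oO; rewrite openE => y [by_ Oy].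
apply: filterI; first by apply: open_nbhs_nbhs; split; [exact: chart_cod_open|].
exact: (chart_inv_continuous by_ (open_nbhs_nbhs (conj oO Oy))).
Qed.

Lemma transition_domE a b : chart_map b @` (chart_dom b `&` chart_dom a) =
  [set y | chart_cod b y /\ chart_dom a (chart_inv b y)].
Proof.
apply/seteqP; split=> [_ [m [bm am] <-]|y [by_ ay]] /=.
  by split; [exists m | rewrite chart_mapK].
have [b1 b2] := chart_cod_inv by_.
by exists (chart_inv b y).
Qed.

Lemma transition_dom_open a b : open (chart_map b @` (chart_dom b `&` chart_dom a)).
Proof. by rewrite transition_domE; apply: open_chart_preimage; exact: chart_dom_open. Qed.

(** Here y is a value of the chart b, while chi lives in the chart a: this is the expression in b of
    chi times g, continued by 0 outside the domain of a. *)
Definition extend0 (W : normedModType R) a b (chi : 'rV[R]_n -> R)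
    (g : 'rV[R]_n -> W) (y : 'rV[R]_n) : W :=
  if `[< chart_dom a (chart_inv b y) >]
  then chi (chart_map a (chart_inv b y)) *: g y else 0.

Lemma smooth_extend0 (W : normedModType R) a b chi (g : 'rV[R]_n -> W) :
  smooth_on setT chi -> compactly_supported_in a chi ->
  smooth_on (chart_map b @` (chart_dom b `&` chart_dom a)) g ->
  smooth_on (chart_cod b) (extend0 a b chi g).
Proof.
move=> schi [K [cK Ka chiK]] sg k; apply: Ck_local => y by_.
have [ay|nay] := pselect (chart_dom a (chart_inv b y)).
  exists (chart_map b @` (chart_dom b `&` chart_dom a)).
  split; first by rewrite transition_domE.
  have oU := @transition_dom_open a b.
  have Ctr : Ck k (chart_map b @` (chart_dom b `&` chart_dom a))
      (chi \o (chart_map a \o chart_inv b)).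
    by apply: (Ck_comp (@row_coordinatized R n) oU _ (chart_transition b a k) (schi k)).
  apply: (Ck_ext oU _ (Ck_scale oU Ctr (sg k))) => z.
  by rewrite transition_domE => -[_ az]; rewrite /extend0 asboolT.
(* Near a point outside the domain of a, the extension vanishes on all of O: off the domain of a by
   definition, and inside it because chi is 0 off K. *)
pose O := ~` (chart_inv a @` K).
exists [set y | chart_cod b y /\ O (chart_inv b y)]; split.
  split=> // -[x Kx Ex]; apply: nay; rewrite -Ex.
  by have [] := chart_cod_inv (Ka _ Kx).
have oO : open [set y | chart_cod b y /\ O (chart_inv b y)].
  by apply: open_chart_preimage; apply: closed_openC; exact: closed_chart_inv.
apply: (Ck_ext oO _ (Ck_cst k _ (0 : W))) => z [bz Oz] /=.
rewrite /extend0; case: ifPn => // /asboolP az.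
have [->|nz] := eqVneq (chi (chart_map a (chart_inv b z))) 0; first by rewrite scale0r.
by case: Oz; exists (chart_map a (chart_inv b z)); [exact: chiK | exact: chart_mapK].
Qed.
End ChartBump.

(** * The tensors of a second-order equation and the Massa-Pagani connection *)

Section LocalExpressions.
Context {R : realType} {n : nat}.
Implicit Types (F : coords R n -> 'rV[R]_n) (y v w : coords R n)
  (c d : coords R n -> coords R n) (i j : 'I_n).

Lemma coordsP v w : v.1.1 = w.1.1 -> (forall i, v.1.2 0 i = w.1.2 0 i) ->
  (forall i, v.2 0 i = w.2 0 i) -> v = w.
Proof.
case: v w => [[t x] u] [[s z] p] /= -> xz up; congr (_, _, _).
  by apply/rowP.
by apply/rowP.
Qed.

Lemma sum_d_xE (a : 'I_n -> R) : \sum_i a i *: d_x i = (0, \row_i a i, 0) :> coords R n.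
Proof.
rewrite [X in (_, X, _)]row_sum_delta.
rewrite [RHS](big_morph (fun z => (0, z, 0) : coords R n) (id1 := 0) (op1 := +%R)) //.
  by apply: eq_bigr => i _; rewrite mxE; congr (_, _, _); rewrite ?scaler0 ?mulr0.
by move=> z z'; congr (_, _, _); rewrite addr0.
Qed.

Lemma sum_d_uE (a : 'I_n -> R) : \sum_i a i *: d_u i = (0, 0, \row_i a i) :> coords R n.
Proof.
rewrite [X in (_, _, X)]row_sum_delta.
rewrite [RHS](big_morph (fun z => (0, 0, z) : coords R n) (id1 := 0) (op1 := +%R)) //.
  by apply: eq_bigr => i _; rewrite mxE; congr (_, _, _); rewrite ?scaler0 ?mulr0.
by move=> z z'; congr (_, _, _); rewrite addr0.
Qed.

Lemma sum_HE F y (a : 'I_n -> R) : \sum_i a i *: H_frame F i y =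
  (0, \row_i a i, \row_k - \sum_i Gamma_coef F k i y * a i).
Proof.
have E (k : unit + 'I_n + 'I_n) : coord_lin k (\sum_i a i *: H_frame F i y) =
    \sum_i a i * coord_lin k (0, delta_mx 0 i, \row_k - Gamma_coef F k i y).
  rewrite linear_sum; apply: eq_bigr => i _; rewrite linearZ /=; congr (_ * _).
  congr (coord_lin k _); rewrite /H_frame sum_d_uE.
  by apply: coordsP => [|j|j]; rewrite /= ?subr0 // !mxE ?subr0 ?sub0r.
apply: coordsP => [|k|k].
- by rewrite [LHS](E (inl (inl tt))) big1 // => i _; rewrite /= mulr0.
- rewrite [LHS](E (inl (inr k))) mxE (bigD1 k) //= mxE !eqxx mulr1 big1 ?addr0 // => i ik.
  by rewrite /= mxE eqxx eq_sym (negbTE ik) mulr0.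
- rewrite [LHS](E (inr k)) mxE -sumrN; apply: eq_bigr => i _.
  by rewrite /= mxE mulrN mulrC.
Qed.

Lemma sode_vecE F y : sode_vec F y = (1, y.2, F y).
Proof.
rewrite /sode_vec sum_d_xE sum_d_uE.
by apply: coordsP => [|i|i] /=; rewrite ?addr0 // !mxE ?addr0 ?add0r.
Qed.

Lemma S_exprE y v : S_expr y v = (0, 0, \row_i theta i y v).
Proof. exact: sum_d_uE. Qed.

Lemma PV_exprE F y v : PV_expr F y v = (0, 0, \row_i psi F i y v).
Proof. exact: sum_d_uE. Qed.

Lemma derive_coord_u v y i : 'D_v (fun z : coords R n => z.2 0 i) y = v.2 0 i.
Proof.
have cL := (@coords_coordinatized R n).1 (inr i).
have dL : differentiable (coord_lin (inr i)) y by exact: linear_differentiable.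
by rewrite [LHS](deriveE v dL) (diff_lin _ cL).
Qed.

Lemma Q_exprE F y v : Q_expr F y v =
  (0, \row_i psi F i y v, \row_k - \sum_i Gamma_coef F k i y * psi F i y v).
Proof. exact: sum_HE. Qed.

Lemma PH_exprE F y v : PH_expr F y v =
  (0, \row_i theta i y v, \row_k - \sum_i Gamma_coef F k i y * theta i y v).
Proof. exact: sum_HE. Qed.

Lemma theta_S i y v : theta i y (S_expr y v) = 0.
Proof. by rewrite S_exprE /theta /= mxE mulr0 subr0. Qed.

Lemma theta_PV F i y v : theta i y (PV_expr F y v) = 0.
Proof. by rewrite PV_exprE /theta /= mxE mulr0 subr0. Qed.

Lemma theta_Q F i y v : theta i y (Q_expr F y v) = psi F i y v.
Proof. by rewrite Q_exprE /theta /= mxE mulr0 subr0. Qed.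

Lemma theta_PH F i y v : theta i y (PH_expr F y v) = theta i y v.
Proof. by rewrite PH_exprE {1}/theta /= mxE mulr0 subr0. Qed.

Lemma theta_sode F i y : theta i y (sode_vec F y) = 0.
Proof. by rewrite sode_vecE /theta /= mulr1 subrr. Qed.

Lemma psi_S F i y v : psi F i y (S_expr y v) = theta i y v.
Proof.
rewrite {1}/psi; under eq_bigr do rewrite theta_S mulr0.
by rewrite big1 // S_exprE /= mxE mulr0 subr0 addr0.
Qed.

Lemma psi_PV F i y v : psi F i y (PV_expr F y v) = psi F i y v.
Proof.
rewrite {1}/psi; under eq_bigr do rewrite theta_PV mulr0.
by rewrite big1 // PV_exprE /= mxE mulr0 subr0 addr0.
Qed.

Lemma psi_Q F i y v : psi F i y (Q_expr F y v) = 0.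
Proof.
rewrite {1}/psi; under eq_bigr do rewrite theta_Q.
by rewrite Q_exprE /= mxE mulr0 subr0 addNr.
Qed.

Lemma psi_PH F i y v : psi F i y (PH_expr F y v) = 0.
Proof.
rewrite {1}/psi; under eq_bigr do rewrite theta_PH.
by rewrite PH_exprE /= mxE mulr0 subr0 addNr.
Qed.

Lemma psi_sode F i y : psi F i y (sode_vec F y) = 0.
Proof.
rewrite {1}/psi; under eq_bigr do rewrite theta_sode mulr0.
by rewrite big1 // sode_vecE /= mulr1 subrr addr0.
Qed.

Lemma theta_lin i y (b : R) v w :
  theta i y (b *: v + w) = b * theta i y v + theta i y w.
Proof.
by rewrite /theta -[(b *: v + w).1.1]/(b * v.1.1 + w.1.1) /= !mxE; ring.
Qed.

Lemma psi_lin F i y (b : R) v w :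
  psi F i y (b *: v + w) = b * psi F i y v + psi F i y w.
Proof.
rewrite /psi; under eq_bigr do rewrite theta_lin mulrDr mulrCA.
rewrite big_split -mulr_sumr -[(b *: v + w).1.1]/(b * v.1.1 + w.1.1) /= !mxE.
by ring.
Qed.

Lemma frame_decomposition F y v :
  v = v.1.1 *: sode_vec F y + PH_expr F y v + PV_expr F y v.
Proof.
rewrite PH_exprE PV_exprE sode_vecE; apply: coordsP => [|i|i].
- by rewrite /= !addr0 [RHS]mulr1.
- by rewrite /= !mxE /theta; ring.
- by rewrite /= !mxE /psi; ring.
Qed.

(** Moving along (0, 0, w) leaves (t, x) fixed, so the difference quotient is identically 0. This
    applies in particular to the components of a vertical lift. *)
Lemma derive_vertical (g : R * 'rV[R]_n -> R) y (w : 'rV[R]_n) :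
  'D_((0, 0, w) : coords R n) (fun z : coords R n => g z.1) y = 0.
Proof.
rewrite /derive; set q := (fun h : R => _).
have -> : q = cst 0.
  apply/funext => h; rewrite /q; apply: etrans (scaler0 _ h^-1); congr (_ *: _).
  apply/eqP; rewrite subr_eq0; apply/eqP; congr (g _).
  by apply: injective_projections; rewrite /= scaler0 add0r.
exact: lim_cst.
Qed.

Lemma derive_fun_cst (g : coords R n -> R) (k : R) y v :
  (forall z, g z = k) -> 'D_v g y = 0.
Proof.
by move=> gk; have -> : g = cst k; [exact/funext | exact: derive_cst].
Qed.

Lemma bracket_tE c d y : differentiable c y -> differentiable d y ->
  ('D_(c y) d y - 'D_(d y) c y).1.1 =
  'D_(c y) (fun z => (d z).1.1) y - 'D_(d y) (fun z => (c z).1.1) y.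
Proof.
move=> dc dd; have cL := (@coords_coordinatized R n).1 (inl (inl tt)).
by have := derive_lin (d y) cL dc; have := derive_lin (c y) cL dd => /= -> ->.
Qed.

Lemma bracket_xE c d y i : differentiable c y -> differentiable d y ->
  ('D_(c y) d y - 'D_(d y) c y).1.2 0 i =
  'D_(c y) (fun z => (d z).1.2 0 i) y - 'D_(d y) (fun z => (c z).1.2 0 i) y.
Proof.
move=> dc dd; have cL := (@coords_coordinatized R n).1 (inl (inr i)).
have := derive_lin (d y) cL dc; have := derive_lin (c y) cL dd => /= -> ->.
by rewrite !mxE.
Qed.

Lemma bracket_uE c d y i : differentiable c y -> differentiable d y ->
  ('D_(c y) d y - 'D_(d y) c y).2 0 i =
  'D_(c y) (fun z => (d z).2 0 i) y - 'D_(d y) (fun z => (c z).2 0 i) y.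
Proof.
move=> dc dd; have cL := (@coords_coordinatized R n).1 (inr i).
have := derive_lin (d y) cL dc; have := derive_lin (c y) cL dd => /= -> ->.
by rewrite !mxE.
Qed.


Lemma eq_S_expr (b : 'I_n -> R) y v : (forall i, theta i y v = b i) ->
  S_expr y v = \sum_i b i *: d_u i.
Proof. by move=> vb; apply: eq_bigr => i _; rewrite vb. Qed.

Lemma eq_PV_expr F (b : 'I_n -> R) y v : (forall i, psi F i y v = b i) ->
  PV_expr F y v = \sum_i b i *: d_u i.
Proof. by move=> vb; apply: eq_bigr => i _; rewrite vb. Qed.

Lemma eq_Q_expr F (b : 'I_n -> R) y v : (forall i, psi F i y v = b i) ->
  Q_expr F y v = \sum_i b i *: H_frame F i y.
Proof. by move=> vb; apply: eq_bigr => i _; rewrite vb. Qed.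

Lemma eq_PH_expr F (b : 'I_n -> R) y v : (forall i, theta i y v = b i) ->
  PH_expr F y v = \sum_i b i *: H_frame F i y.
Proof. by move=> vb; apply: eq_bigr => i _; rewrite vb. Qed.

Lemma sum_scale0 (W : lmodType R) (w : 'I_n -> W) : \sum_i (0 : R) *: w i = 0.
Proof. by rewrite big1 // => i _; rewrite scale0r. Qed.

Definition coframeE :=
  (theta_S, theta_PV, theta_Q, theta_PH, psi_S, psi_PV, psi_Q, psi_PH).

End LocalExpressions.

Section SodeTensors.
Context {R : realType} {n : nat} {M : smooth_manifold R n}.
Variables (Gamma : vfield M) (hGamma : is_sode Gamma) (B : sode_tensors Gamma).
Implicit Types (a : chart M) (f h : Cinf M) (X Y Z U V : vfield M)
  (c d : coords R n -> coords R n).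

Local Notation S := (tS B).
Local Notation Q := (tQ B).
Local Notation P_V := (tPV B).
Local Notation P_H := (tPH B).

(** Reduces an identity of global vector fields to one between component functions, in a chart where
    Gamma has a known forcing term F. *)
Lemma eq_vf_local X Y :
  (forall a F, sode_coef Gamma a F -> exists c d,
    [/\ in_chart a X c, in_chart a Y d & forall y, adapted_cod a y -> c y = d y]) ->
  X = Y.
Proof.
move=> XY; apply: vfieldP => f e; have [a ae] := adapted_chart_at e.
have [F hF] := hGamma a; have [c [d [Xc Yd cd]]] := XY a F hF.
exact: in_chart_eq Xc Yd cd f e ae.
Qed.

Lemma in_chart0 a : in_chart a (0 : vfield M) (cst 0).
Proof.
split; first exact: smooth_cst.
by move=> f g fg e ae; rewrite derive0.
Qed.

Lemma in_chartD a X Y c d : in_chart a X c -> in_chart a Y d ->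
  in_chart a (X + Y) (fun y => c y + d y).
Proof.
move=> [sc Xc] [sd Yd]; split; first exact: smoothD (@adapted_cod_open _ _ M a) sc sd.
move=> f g fg e ae; have dg := local_expr_differentiable fg ae.
by rewrite deriveE // linearD /= -!deriveE // -(Xc f g) // -(Yd f g).
Qed.

Lemma in_chartN a X c : in_chart a X c -> in_chart a (- X) (fun y => - c y).
Proof.
move=> [sc Xc]; split; first exact: smoothN (@adapted_cod_open _ _ M a) sc.
move=> f g fg e ae; have dg := local_expr_differentiable fg ae.
by rewrite deriveE // linearN /= -deriveE // -(Xc f g).
Qed.

Lemma in_chartZ a f k X c : local_expr a f k -> in_chart a X c ->
  in_chart a (f *: X) (fun y => k y *: c y).
Proof.
move=> [sk fk] [sc Xc]; split; first exact: smoothZ (@adapted_cod_open _ _ M a) sk sc.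
move=> h g hg e ae; have dg := local_expr_differentiable hg ae.
by rewrite deriveE // linearZ /= -deriveE // -(Xc h g) // -fk.
Qed.

Lemma dt_in_chart a X c e : in_chart a X c -> adapted_dom a e ->
  dt X e = (c (adapted_map a e)).1.1.
Proof.
move=> [_ Xc] ae.
have lt : local_expr a (time M) (coord_lin (inl (inl tt))).
  split=> // k.
  exact: (Ck_lin (coords_coordinatized.1 (inl (inl tt))) (@adapted_cod_open _ _ M a) (Ck_id k _)).
rewrite /dt (Xc _ _ lt) // deriveE; last first.
  by apply: linear_differentiable; exact: coords_coordinatized.1.
by rewrite diff_lin //; exact: coords_coordinatized.1.
Qed.

(** [sode_tensors] prescribes the tensors only by their expressions in coordinates; linearity over
    smooth functions is recovered from the linearity of the expression on each tangent space. *)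
Lemma tensor_lin (T : vfield M -> vfield M) expr f X Y :
  tensor_expr Gamma T expr ->
  (forall F y (b : R) v w,
    expr F y (b *: v + w) = b *: expr F y v + expr F y w) ->
  T (f *: X + Y) = f *: T X + T Y.
Proof.
move=> TE lin_expr; apply: eq_vf_local => a F hF.
have [[c Xc] [d Yd]] := (vf_chart X a, vf_chart Y a).
have [k fk] := cinf_expr f a.
have XYcd := in_chartD (in_chartZ fk Xc) Yd.
have TXYcd := in_chartD (in_chartZ fk (TE _ _ hF _ _ Xc)) (TE _ _ hF _ _ Yd).
by do 2 eexists; split; [exact: TE _ _ hF _ _ XYcd | exact: TXYcd |].
Qed.

Lemma S_lin f X Y : S (f *: X + Y) = f *: S X + S Y.
Proof.
apply: tensor_lin (tS_expr B) _ => F y b v w; rewrite !S_exprE.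
apply: coordsP => [|i|i] /=; rewrite ?mxE ?theta_lin //.
- by rewrite addr0 [RHS]mulr0.
- by rewrite addr0 mulr0.
Qed.

Lemma PV_lin f X Y : P_V (f *: X + Y) = f *: P_V X + P_V Y.
Proof.
apply: tensor_lin (tPV_expr B) _ => F y b v w; rewrite !PV_exprE.
apply: coordsP => [|i|i] /=; rewrite ?mxE ?psi_lin //.
- by rewrite addr0 [RHS]mulr0.
- by rewrite addr0 mulr0.
Qed.

Lemma Q_lin f X Y : Q (f *: X + Y) = f *: Q X + Q Y.
Proof.
apply: tensor_lin (tQ_expr B) _ => F y b v w.
rewrite /Q_expr scaler_sumr -big_split /=; apply: eq_bigr => i _.
by rewrite psi_lin scalerDl scalerA.
Qed.

Lemma PH_lin f X Y : P_H (f *: X + Y) = f *: P_H X + P_H Y.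
Proof.
apply: tensor_lin (tPH_expr B) _ => F y b v w.
rewrite /PH_expr scaler_sumr -big_split /=; apply: eq_bigr => i _.
by rewrite theta_lin scalerDl scalerA.
Qed.

Lemma tensor_comp (T1 T2 T3 : vfield M -> vfield M) e1 e2 e3 X :
  tensor_expr Gamma T1 e1 -> tensor_expr Gamma T2 e2 -> tensor_expr Gamma T3 e3 ->
  (forall F y v, e1 F y (e2 F y v) = e3 F y v) -> T1 (T2 X) = T3 X.
Proof.
move=> E1 E2 E3 E123; apply: eq_vf_local => a F hF; have [c Xc] := vf_chart X a.
do 2 eexists; split; [exact: E1 _ _ hF _ _ (E2 _ _ hF _ _ Xc) |
  exact: E3 _ _ hF _ _ Xc |] => y _ /=; exact: E123.
Qed.

(** * Algebra of S, Q and the projectors *)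

Lemma zero_expr : tensor_expr Gamma (fun=> 0 : vfield M) (fun _ _ _ => 0).
Proof. by move=> a F _ X c _; exact: in_chart0. Qed.

Lemma SS X : S (S X) = 0.
Proof.
apply: (tensor_comp _ (tS_expr B) (tS_expr B) zero_expr) => F y v.
by rewrite (@eq_S_expr _ _ (fun=> 0)) ?sum_scale0 // => i; rewrite coframeE.
Qed.

Lemma SPV X : S (P_V X) = 0.
Proof.
apply: (tensor_comp _ (tS_expr B) (tPV_expr B) zero_expr) => F y v.
by rewrite (@eq_S_expr _ _ (fun=> 0)) ?sum_scale0 // => i; rewrite coframeE.
Qed.

Lemma SQ X : S (Q X) = P_V X.
Proof.
apply: (tensor_comp _ (tS_expr B) (tQ_expr B) (tPV_expr B)) => F y v.
by apply: eq_S_expr => i; rewrite coframeE.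
Qed.

Lemma SPH X : S (P_H X) = S X.
Proof.
apply: (tensor_comp _ (tS_expr B) (tPH_expr B) (tS_expr B)) => F y v.
by apply: eq_S_expr => i; rewrite coframeE.
Qed.

Lemma QS X : Q (S X) = P_H X.
Proof.
apply: (tensor_comp _ (tQ_expr B) (tS_expr B) (tPH_expr B)) => F y v.
by apply: eq_Q_expr => i; rewrite coframeE.
Qed.

Lemma QPV X : Q (P_V X) = Q X.
Proof.
apply: (tensor_comp _ (tQ_expr B) (tPV_expr B) (tQ_expr B)) => F y v.
by apply: eq_Q_expr => i; rewrite coframeE.
Qed.

Lemma QQ X : Q (Q X) = 0.
Proof.
apply: (tensor_comp _ (tQ_expr B) (tQ_expr B) zero_expr) => F y v.
by rewrite (@eq_Q_expr _ _ _ (fun=> 0)) ?sum_scale0 // => i; rewrite coframeE.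
Qed.

Lemma QPH X : Q (P_H X) = 0.
Proof. by rewrite -QS QQ. Qed.

Lemma SD X Y : S (X + Y) = S X + S Y.
Proof. by have := S_lin 1 X Y; rewrite !scale1r. Qed.
Lemma QD X Y : Q (X + Y) = Q X + Q Y.
Proof. by have := Q_lin 1 X Y; rewrite !scale1r. Qed.
Lemma PHD X Y : P_H (X + Y) = P_H X + P_H Y.
Proof. by have := PH_lin 1 X Y; rewrite !scale1r. Qed.
Lemma PVD X Y : P_V (X + Y) = P_V X + P_V Y.
Proof. by have := PV_lin 1 X Y; rewrite !scale1r. Qed.

Lemma S0 : S 0 = 0.
Proof. by have := SD 0 0; rewrite addr0 -[LHS]addr0 => /addrI. Qed.
Lemma Q0 : Q 0 = 0.
Proof. by have := QD 0 0; rewrite addr0 -[LHS]addr0 => /addrI. Qed.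
Lemma PH0 : P_H 0 = 0.
Proof. by rewrite -QS S0 Q0. Qed.
Lemma PV0 : P_V 0 = 0.
Proof. by rewrite -SQ Q0 S0. Qed.

Lemma SZ f X : S (f *: X) = f *: S X.
Proof. by have := S_lin f X 0; rewrite S0 !addr0. Qed.
Lemma QZ f X : Q (f *: X) = f *: Q X.
Proof. by have := Q_lin f X 0; rewrite Q0 !addr0. Qed.
Lemma PHZ f X : P_H (f *: X) = f *: P_H X.
Proof. by have := PH_lin f X 0; rewrite PH0 !addr0. Qed.
Lemma PVZ f X : P_V (f *: X) = f *: P_V X.
Proof. by have := PV_lin f X 0; rewrite PV0 !addr0. Qed.

Lemma SN X : S (- X) = - S X.
Proof. by apply/eqP; rewrite -addr_eq0 -SD addNr S0. Qed.
Lemma QN X : Q (- X) = - Q X.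
Proof. by apply/eqP; rewrite -addr_eq0 -QD addNr Q0. Qed.
Lemma PHN X : P_H (- X) = - P_H X.
Proof. by apply/eqP; rewrite -addr_eq0 -PHD addNr PH0. Qed.
Lemma PVN X : P_V (- X) = - P_V X.
Proof. by apply/eqP; rewrite -addr_eq0 -PVD addNr PV0. Qed.

Lemma PHS X : P_H (S X) = 0. Proof. by rewrite -QS SS Q0. Qed.
Lemma PHQ X : P_H (Q X) = Q X. Proof. by rewrite -QS SQ QPV. Qed.
Lemma PVS X : P_V (S X) = S X. Proof. by rewrite -SQ QS SPH. Qed.
Lemma PVQ X : P_V (Q X) = 0. Proof. by rewrite -SQ QQ S0. Qed.
Lemma PHPH X : P_H (P_H X) = P_H X. Proof. by rewrite -QS SPH QS. Qed.
Lemma PHPV X : P_H (P_V X) = 0. Proof. by rewrite -QS SPV Q0. Qed.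
Lemma PVPH X : P_V (P_H X) = 0. Proof. by rewrite -SQ QPH S0. Qed.
Lemma PVPV X : P_V (P_V X) = P_V X. Proof. by rewrite -SQ QPV SQ. Qed.

Lemma S_Gamma : S Gamma = 0.
Proof.
apply: eq_vf_local => a F hF.
do 2 eexists; split; [exact: (tS_expr B hF hF.2) | exact: in_chart0 |] => y _ /=.
by rewrite (@eq_S_expr _ _ (fun=> 0)) ?sum_scale0 // => i; rewrite theta_sode.
Qed.

Lemma Q_Gamma : Q Gamma = 0.
Proof.
apply: eq_vf_local => a F hF.
do 2 eexists; split; [exact: (tQ_expr B hF hF.2) | exact: in_chart0 |] => y _ /=.
by rewrite (@eq_Q_expr _ _ _ (fun=> 0)) ?sum_scale0 // => i; rewrite psi_sode.
Qed.

Lemma PH_Gamma : P_H Gamma = 0. Proof. by rewrite -QS S_Gamma Q0. Qed.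
Lemma PV_Gamma : P_V Gamma = 0. Proof. by rewrite -SQ Q_Gamma S0. Qed.

Lemma dt_Gamma : dt Gamma = 1.
Proof.
apply: cinfP => e; have [a ae] := adapted_chart_at e; have [F hF] := hGamma a.
by rewrite (dt_in_chart hF.2 ae) sode_vecE.
Qed.

Lemma dtS X : dt (S X) = 0.
Proof.
apply: cinfP => e; have [a ae] := adapted_chart_at e; have [F hF] := hGamma a.
have [c Xc] := vf_chart X a.
by rewrite (dt_in_chart (tS_expr B hF Xc) ae) S_exprE.
Qed.

Lemma dtQ X : dt (Q X) = 0.
Proof.
apply: cinfP => e; have [a ae] := adapted_chart_at e; have [F hF] := hGamma a.
have [c Xc] := vf_chart X a.
by rewrite (dt_in_chart (tQ_expr B hF Xc) ae) Q_exprE.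
Qed.

Lemma dtPH X : dt (P_H X) = 0. Proof. by rewrite -QS dtQ. Qed.
Lemma dtPV X : dt (P_V X) = 0. Proof. by rewrite -SQ dtS. Qed.

Lemma vf_decomposition X : X = dt X *: Gamma + P_H X + P_V X.
Proof.
apply: vfieldP => f e; have [a ae] := adapted_chart_at e; have [F hF] := hGamma a.
have [[c Xc] [g fg]] := (vf_chart X a, cinf_expr f a).
have dg := local_expr_differentiable fg ae.
have := frame_decomposition F (adapted_map a e) (c (adapted_map a e)).
rewrite !vfDE vfZE !cinfDE cinfME (dt_in_chart Xc ae).
rewrite (hF.2.2 _ _ fg _ ae) ((tPH_expr B hF Xc).2 _ _ fg _ ae).
rewrite ((tPV_expr B hF Xc).2 _ _ fg _ ae) (Xc.2 _ _ fg _ ae) !deriveE //.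
by move=> {1}->; rewrite 2!linearD linearZ.
Qed.

Lemma verticalP X : vertical X -> P_V X = X.
Proof.
move=> vX; apply: eq_vf_local => a F hF; have [w Xw] := vX a.
do 2 eexists; split; [exact: (tPV_expr B hF Xw) | exact: Xw |] => y _ /=.
apply: eq_PV_expr => i; rewrite sum_d_uE /psi big1 /= ?mxE ?mulr0 ?subr0 ?addr0 //.
by move=> j _; rewrite /theta /= mxE mulr0 subr0 mulr0.
Qed.

Lemma vertical_S X : vertical (S X).
Proof.
move=> a; have [F hF] := hGamma a; have [c Xc] := vf_chart X a.
exists (fun y => \row_i theta i y (c y)).
have -> : (fun y => \sum_i (\row_i theta i y (c y)) 0 i *: V_frame i) =
    (fun y => S_expr y (c y)).
  by apply/funext => y; apply: eq_bigr => i _; rewrite mxE.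
exact: (tS_expr B hF Xc).
Qed.

Lemma vertical_PV X : vertical (P_V X).
Proof. by rewrite -SQ; exact: vertical_S. Qed.

(** * The identities between brackets that are verified in coordinates *)

Lemma bracket_PV X Y : P_V (bracket (P_V X) (P_V Y)) = bracket (P_V X) (P_V Y).
Proof.
apply: eq_vf_local => a F hF.
have [[c Xc] [d Yd]] := (vf_chart X a, vf_chart Y a).
have Vc := tPV_expr B hF Xc; have Vd := tPV_expr B hF Yd.
have VV := in_chart_bracket Vc Vd.
do 2 eexists; split; [exact: (tPV_expr B hF VV) | exact: VV |] => y ay /=.
have [dc dd] := (smooth_differentiable Vc.1 ay, smooth_differentiable Vd.1 ay).
set b := _ - _.
have b1 : b.1.1 = 0.
  rewrite /b bracket_tE // !(@derive_fun_cst _ _ _ 0) ?subr0 // => z.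
    by rewrite PV_exprE.
  by rewrite PV_exprE.
have b2 i : b.1.2 0 i = 0.
  rewrite /b bracket_xE // !(@derive_fun_cst _ _ _ 0) ?subr0 // => z.
    by rewrite PV_exprE mxE.
  by rewrite PV_exprE mxE.
rewrite [RHS](frame_decomposition F y b) b1 scale0r add0r.
rewrite (@eq_PH_expr _ _ _ (fun=> 0)) ?sum_scale0 ?add0r // => i.
by rewrite /theta b1 b2 mulr0 subr0.
Qed.

(** S X has no t and x components, and Gamma has the x components u^i; hence the x components of the
    bracket are -(S X)(u^i) = -theta^i(X). *)
Lemma PH_bracket_Gamma_S X : P_H (bracket Gamma (S X)) = - P_H X.
Proof.
rewrite -PHN; apply: eq_vf_local => a F hF; have [c Xc] := vf_chart X a.
have Sc := tS_expr B hF Xc.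
have GS := in_chart_bracket hF.2 Sc.
do 2 eexists; split; [exact: (tPH_expr B hF GS) | exact: (tPH_expr B hF (in_chartN Xc)) |].
move=> y ay /=.
have [dG dS] := (smooth_differentiable hF.2.1 ay, smooth_differentiable Sc.1 ay).
apply: eq_PH_expr => i; rewrite /theta bracket_tE // bracket_xE //.
have -> : (fun z => (S_expr z (c z)).1.1) = cst 0.
  by apply/funext => z; rewrite S_exprE.
have -> : (fun z => (S_expr z (c z)).1.2 0 i) = cst 0.
  by apply/funext => z; rewrite S_exprE /= mxE.
have -> : (fun z => (sode_vec F z).1.1) = cst 1.
  by apply/funext => z; rewrite sode_vecE.
have -> : (fun z => (sode_vec F z).1.2 0 i) = (fun z => z.2 0 i).
  by apply/funext => z; rewrite sode_vecE.
by rewrite derive_coord_u !derive_cst S_exprE /= !mxE /theta; ring.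
Qed.

(** This is where the factor -1/2 in [Gamma_coef] matters. With th^i = theta^i(X), the left side has
    components Gamma(th^i) - (S X)(F^i) - Gamma^i_j th^j, and -(S X)(F^i) = 2 Gamma^i_j th^j. The
    right side has Gamma(th^i) - (P_H X)(u^i) = Gamma(th^i) + Gamma^i_j th^j. *)
Lemma PV_bracket_Gamma_S X : P_V (bracket Gamma (S X)) = S (bracket Gamma (P_H X)).
Proof.
apply: eq_vf_local => a F hF; have [c Xc] := vf_chart X a.
have [Sc Hc] := (tS_expr B hF Xc, tPH_expr B hF Xc).
have [GS GH] := (in_chart_bracket hF.2 Sc, in_chart_bracket hF.2 Hc).
do 2 eexists; split; [exact: (tPV_expr B hF GS) | exact: (tS_expr B hF GH) |].
move=> y ay /=.
have dG := smooth_differentiable hF.2.1 ay.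
have [dS dH] := (smooth_differentiable Sc.1 ay, smooth_differentiable Hc.1 ay).
have dF := smooth_differentiable hF.1 ay.
have G1 : (fun z => (sode_vec F z).1.1) = cst 1.
  by apply/funext => z; rewrite sode_vecE.
have G2 j : (fun z => (sode_vec F z).1.2 0 j) = (fun z => z.2 0 j).
  by apply/funext => z; rewrite sode_vecE.
have S1 : (fun z => (S_expr z (c z)).1.1) = cst 0.
  by apply/funext => z; rewrite S_exprE.
have S2 j : (fun z => (S_expr z (c z)).1.2 0 j) = cst 0.
  by apply/funext => z; rewrite S_exprE /= mxE.
have H1 : (fun z => (PH_expr F z (c z)).1.1) = cst 0.
  by apply/funext => z; rewrite PH_exprE.
have H2 j : (fun z => (PH_expr F z (c z)).1.2 0 j) = (fun z => theta j z (c z)).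
  by apply/funext => z; rewrite PH_exprE /= mxE.
have G3 j : (fun z => (sode_vec F z).2 0 j) = (fun z => F z 0 j).
  by apply/funext => z; rewrite sode_vecE.
have S3 j : (fun z => (S_expr z (c z)).2 0 j) = (fun z => theta j z (c z)).
  by apply/funext => z; rewrite S_exprE /= mxE.
have DF i : 'D_(S_expr y (c y)) (fun z => F z 0 i) y =
    - 2 * \sum_j Gamma_coef F i j y * theta j y (c y).
  have dFi : differentiable (fun z => F z 0 i) y.
    apply: (@differentiable_comp _ _ _ _ F (fun N : 'rV[R]_n => N 0 i)) => //.
    exact: differentiable_coord.
  rewrite deriveE // /S_expr linear_sum mulr_sumr; apply: eq_bigr => j _.
  by rewrite linearZ /= -deriveE // /Gamma_coef -[_ *: _]/(_ * _); field.
apply: eq_PV_expr => i; rewrite /theta.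
rewrite (bracket_tE dG dH) (bracket_xE _ dG dH) G1 H1 G2 H2 !derive_cst.
rewrite derive_coord_u /psi (bracket_tE dG dS) (bracket_uE _ dG dS) G1 S1 G3 S3.
under eq_bigr do rewrite {1}/theta (bracket_tE dG dS) (bracket_xE _ dG dS)
  G1 S1 G2 S2 !derive_cst derive_coord_u S_exprE /= mxE subr0 mulr0 subr0 sub0r mulrN.
rewrite !derive_cst DF sumrN PH_exprE /= mxE; ring.
Qed.

(** The x components of Q U are those of U, functions of (t, x) killed by V; the x components of V
    are 0. So the bracket has no t and x components. *)
Lemma S_bracket_vertical_lift V U : vertical V -> vertical_lift U ->
  S (bracket V (Q U)) = 0.
Proof.
move=> vV lU; apply: eq_vf_local => a F hF; have [[w Vw] [u Uu]] := (vV a, lU a).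
have Qu := tQ_expr B hF Uu; have VQ := in_chart_bracket Vw Qu.
do 2 eexists; split; [exact: (tS_expr B hF VQ) | exact: in_chart0 |] => y ay /=.
have [dV dQ] := (smooth_differentiable Vw.1 ay, smooth_differentiable Qu.1 ay).
rewrite (@eq_S_expr _ _ (fun=> 0)) ?sum_scale0 // => i.
rewrite /theta bracket_tE // bracket_xE //.
have -> : (fun z => (\sum_i w z 0 i *: V_frame i : coords R n).1.1) = cst 0.
  by apply/funext => z; rewrite sum_d_uE.
have -> : (fun z => (\sum_i w z 0 i *: V_frame i : coords R n).1.2 0 i) = cst 0.
  by apply/funext => z; rewrite sum_d_uE /= mxE.
have -> : (fun z => (Q_expr F z (\sum_i u z.1 0 i *: V_frame i)).1.1) = cst 0.
  by apply/funext => z; rewrite Q_exprE.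
have -> : (fun z => (Q_expr F z (\sum_i u z.1 0 i *: V_frame i)).1.2 0 i) =
    (fun z => u z.1 0 i).
  apply/funext => z; rewrite Q_exprE /= mxE sum_d_uE /psi big1 /= ?mxE.
    by rewrite mulr0 subr0 addr0.
  by move=> j _; rewrite /theta /= mxE mulr0 subr0 mulr0.
rewrite !derive_cst !subr0 mulr0 subr0 sum_d_uE.
exact: (derive_vertical (fun z => u z 0 i)).
Qed.

Definition tensor_linE := (SD, QD, PHD, PVD, SN, QN, PHN, PVN, SZ, QZ, PHZ, PVZ,
  S0, Q0, PH0, PV0).
Definition tensor_compE := (SS, SPV, SQ, SPH, QS, QPV, QQ, QPH,
  (PHS, PHQ, PVS, PVQ, PHPH, PHPV, PVPH, PVPV),
  (S_Gamma, Q_Gamma, PH_Gamma, PV_Gamma)).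
Definition bracket_linE := (@bracketDl R n M, @bracketDr R n M, @bracketNl R n M,
  @bracketNr R n M, @bracketZl R n M, @bracketZr R n M, @bracket0l R n M, @bracket0r R n M).
Definition vf_linE := (tensor_linE, tensor_compE, bracket_linE).

(** * The Massa-Pagani connection: linearity, parallel tensors and torsion *)

Local Notation D := (massa_pagani B).

(** After [vf_linE] has pushed tensors and brackets through sums and multiples, evaluation at a
    function and a point leaves an identity for [ring]. *)
Ltac vf_ring := apply: vfieldP => ? ?;
  rewrite ?(vfDE, vfNE, vf0E, vfZE, cinfDE, cinfNE, cinfME, cinf0E, cinf1E); ring.

Lemma subPH X : X - P_H X = dt X *: Gamma + P_V X.
Proof. by rewrite {1}(vf_decomposition X); vf_ring. Qed.

Lemma subPV X : X - P_V X = dt X *: Gamma + P_H X.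
Proof. by rewrite {1}(vf_decomposition X); vf_ring. Qed.

Lemma massa_pagani_linear : linear_connection D.
Proof.
split=> [f X Y Z|X Y Z|X f Y].
- by rewrite /massa_pagani !vf_linE vfDE vfZE; vf_ring.
- by rewrite /massa_pagani !vf_linE /dt !evalE; vf_ring.
(* In the Leibniz rule, the derivatives of f along P_H X and X - P_H X add up to X f as the
   coefficient of P_H Y, and similarly for P_V Y; so Y is split on the right-hand side as well. *)
- have -> : X f *: Y = X f *: (dt Y *: Gamma + P_H Y + P_V Y).
    by rewrite -vf_decomposition.
  have dtfY : dt (f *: Y) = f * dt Y by [].
  by rewrite /massa_pagani !vf_linE dtfY vfM; vf_ring.
Qed.

Lemma massa_pagani_Gamma X : D X Gamma = 0.
Proof.
by rewrite /massa_pagani dt_Gamma vf1 !vf_linE; vf_ring.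
Qed.

Lemma dt_massa_pagani X Y : dt (D X Y) = X (dt Y).
Proof.
have dtD U V : dt (U + V) = dt U + dt V by [].
have dtZ f V : dt (f *: V) = f * dt V by [].
by rewrite /massa_pagani !dtD dtZ dtQ dtS dtPH dtPV dt_Gamma !addr0 mulr1.
Qed.

(** Applying S permutes the bracket terms of the definition. They match by the algebra of the
    tensors, except for the Gamma component of X, where [PV_bracket_Gamma_S] is needed. *)
Lemma massa_pagani_S X Y : D X (S Y) = S (D X Y).
Proof.
rewrite /massa_pagani !subPH !subPV dtS vf0 !vf_linE PV_bracket_Gamma_S.
by vf_ring.
Qed.

(** Follows from [PV_bracket_Gamma_S] at Q X by applying Q, without a new computation in
    coordinates. *)
Lemma PH_bracket_Gamma_Q X : P_H (bracket Gamma (Q X)) = Q (bracket Gamma (P_V X)).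
Proof. by rewrite -QS -[X in S (bracket _ X)]PHQ -PV_bracket_Gamma_S QPV SQ. Qed.

Lemma massa_pagani_Q X Y : D X (Q Y) = Q (D X Y).
Proof.
rewrite /massa_pagani !subPH !subPV dtQ vf0 !vf_linE PH_bracket_Gamma_Q.
by vf_ring.
Qed.

Lemma dt_bracket_Gamma X : dt X = 0 -> dt (bracket Gamma X) = 0.
Proof. by move=> X0; rewrite dt_bracket X0 dt_Gamma vf0 vf1 subr0. Qed.

Lemma massa_pagani_Gamma_S X : D Gamma (S X) = P_V (bracket Gamma (S X)).
Proof.
by rewrite /massa_pagani dtS vf0 !vf_linE !subr0 !addr0 scale0r !add0r.
Qed.

Lemma bracket_Gamma_S X : bracket Gamma (S X) = P_V (bracket Gamma (S X)) - P_H X.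
Proof.
rewrite {1}(vf_decomposition (bracket _ _)) dt_bracket_Gamma ?dtS //.
by rewrite scale0r add0r PH_bracket_Gamma_S addrC.
Qed.

Lemma massa_pagani_torsion_H X : P_H X = torsion D Gamma (S X).
Proof.
rewrite /torsion massa_pagani_Gamma_S massa_pagani_Gamma subr0.
by rewrite {2}bracket_Gamma_S opprB addrCA subrr addr0.
Qed.

Lemma S_bracket_Gamma_PV X : S (bracket Gamma (P_V X)) = - P_V X.
Proof. by rewrite -SQ -SPH PH_bracket_Gamma_S SN SPH. Qed.

Lemma massa_pagani_torsion_V X : P_V X = S (torsion D Gamma X).
Proof.
rewrite /torsion massa_pagani_Gamma subr0 SD SN -massa_pagani_S.
rewrite massa_pagani_Gamma_S PV_bracket_Gamma_S.
rewrite [X in _ - S (bracket _ X)](vf_decomposition X) !vf_linE.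
rewrite S_bracket_Gamma_PV (_ : bracket Gamma Gamma = 0) ?S0; last by vf_ring.
by vf_ring.
Qed.

Lemma massa_pagani_vertical_lift X U : vertical X -> vertical_lift U -> D X U = 0.
Proof.
move=> vX lU; have vU : vertical U.
  by move=> a; have [w] := lU a; exists (fun y => w y.1).
have [HX HU] : P_H X = 0 /\ P_H U = 0 by rewrite -(verticalP vX) -(verticalP vU) !PHPV.
have SU : S U = 0 by rewrite -(verticalP vU) SPV.
have dtU : dt U = 0 by rewrite -(verticalP vU) dtPV.
rewrite /massa_pagani HX HU SU dtU (verticalP vX) (verticalP vU) subrr vf0.
by rewrite S_bracket_vertical_lift // !vf_linE; vf_ring.
Qed.

(** * Derivatives of vertical fields and the curvature R(Gamma, V) *)

Lemma massa_pagani_Gamma_vertical Z : P_V Z = Z -> D Gamma Z = P_V (bracket Gamma Z).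
Proof. by move=> <-; rewrite -SQ massa_pagani_Gamma_S. Qed.

Lemma massa_pagani_vertical V Z : P_V V = V -> P_V Z = Z -> D V Z = S (bracket V (Q Z)).
Proof.
move=> <- <-; rewrite /massa_pagani PHPV SPV PHPV dtPV PVPV subrr vf0 !PVPV.
by rewrite !bracket0l bracket0r !tensor_linE; vf_ring.
Qed.

Lemma massa_pagani_H X Z : P_V Z = Z -> D (P_H X) Z = P_V (bracket (P_H X) Z).
Proof.
move=> <-; rewrite /massa_pagani PHPH SPV PHPV dtPV PVPH subr0 vf0 !PVPV.
by rewrite !bracket0l !bracket0r !tensor_linE; vf_ring.
Qed.

Lemma S_bracket_vertical V Z : P_V V = V -> P_V Z = Z -> S (bracket V Z) = 0.
Proof. by move=> <- <-; rewrite -bracket_PV SPV. Qed.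

Lemma bracket_Gamma_vertical V : P_V V = V ->
  bracket Gamma V = P_V (bracket Gamma V) - Q V.
Proof.
move=> VE; have SQV : S (Q V) = V by rewrite SQ.
by rewrite -{1}SQV bracket_Gamma_S SQV PHQ.
Qed.

Lemma bracket_Gamma_Q V : P_V V = V ->
  bracket Gamma (Q V) = Q (P_V (bracket Gamma V)) + P_V (bracket Gamma (Q V)).
Proof.
move=> VE; rewrite {1}(vf_decomposition (bracket _ _)) dt_bracket_Gamma ?dtQ //.
by rewrite scale0r add0r PH_bracket_Gamma_Q VE QPV.
Qed.

Lemma S_bracket_Gamma_PH K : dt K = 0 ->
  S (bracket Gamma (P_H K)) = S (bracket Gamma K) + P_V K.
Proof.
move=> K0; rewrite [X in S (bracket _ X) + _](vf_decomposition K) K0 scale0r add0r.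
by rewrite bracketDr SD S_bracket_Gamma_PV addrNK.
Qed.

(* Horizontal part of the Jacobi identity for (Gamma, V, Z). *)
Lemma bracket_verticalE V Z : P_V V = V -> P_V Z = Z ->
  bracket V Z = S (bracket (Q V) Z) + S (bracket V (Q Z)).
Proof.
move=> VE ZE.
have -> : bracket V Z = - S (bracket Gamma (bracket V Z)).
  have {1 2}-> : bracket V Z = P_V (bracket V Z) by rewrite -VE -ZE bracket_PV.
  by rewrite S_bracket_Gamma_PV opprK.
rewrite (jacobi Gamma) SD (bracket_Gamma_vertical VE) (bracket_Gamma_vertical ZE).
rewrite bracketDl bracketDr bracketNl bracketNr !SD !SN.
by rewrite (S_bracket_vertical (PVPV _) ZE) (S_bracket_vertical VE (PVPV _)); vf_ring.
Qed.

(* The vertical part of the Jacobi identity for (Gamma, V, Z) yields twice this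
   identity. *)
Lemma PV_bracket_Q V Z : P_V V = V -> P_V Z = Z ->
  P_V (bracket V (Q Z)) + P_V (bracket (Q V) Z) = S (bracket (Q V) (Q Z)).
Proof.
move=> VE ZE.
set nV := P_V (bracket Gamma V); set nZ := P_V (bracket Gamma Z).
have nVE : P_V nV = nV by exact: PVPV.
have nZE : P_V nZ = nZ by exact: PVPV.
have GV : bracket Gamma V = nV - Q V by exact: bracket_Gamma_vertical.
have GZ : bracket Gamma Z = nZ - Q Z by exact: bracket_Gamma_vertical.
have dtV : dt V = 0 by rewrite -VE dtPV.
have dtZ : dt Z = 0 by rewrite -ZE dtPV.
have vE U W : P_V U = U -> P_V W = W -> P_V (bracket U W) = bracket U W.
  by move=> <- <-; exact: bracket_PV.
set K := bracket (Q V) Z + bracket V (Q Z).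
have dtK : dt K = 0.
  have -> : dt K = dt (bracket (Q V) Z) + dt (bracket V (Q Z)) by [].
  by rewrite !dt_bracket !dtQ dtV dtZ !vf0 !subr0 addr0.
(* [E1] and [E2] compute the same vertical part in two ways: from P_H K = Q [V, Z], and from the
   Jacobi identity. [E3] then eliminates S [Gamma, K]. *)
have E1 : P_V (bracket Gamma (bracket V Z)) = S (bracket Gamma K) + P_V K.
  rewrite -S_bracket_Gamma_PH //.
  have -> : P_H K = Q (bracket V Z) by rewrite -QS /K SD -bracket_verticalE.
  by rewrite -[X in S (bracket _ X)]PHQ -PV_bracket_Gamma_S SQ (vE V Z).
have E2 : P_V (bracket Gamma (bracket V Z)) = bracket nV Z + bracket V nZ - P_V K.
  rewrite jacobi GV GZ !bracket_linE !tensor_linE (vE nV Z) // (vE V nZ) //.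
  by rewrite /K ?PVD; vf_ring.
have E3 : S (bracket Gamma K) = bracket nV Z + bracket V nZ -
    (S (bracket (Q V) (Q Z)) + S (bracket (Q V) (Q Z))).
  rewrite /K bracketDr !(jacobi Gamma) GV GZ (bracket_Gamma_Q VE) (bracket_Gamma_Q ZE).
  rewrite -/nV -/nZ (bracket_verticalE nVE ZE) (bracket_verticalE VE nZE).
  rewrite !bracket_linE !tensor_linE.
  by rewrite (S_bracket_vertical (PVPV _) ZE) (S_bracket_vertical VE (PVPV _)); vf_ring.
move: E1; rewrite E2 E3 /K ?PVD => E.
(* What remains is twice the wanted identity; the division by 2 is made on real values at a
   point. *)
apply: vfieldP => f e; have := congr1 (fun X : vfield M => X f e) E.
by rewrite ?(vfDE, vfNE, cinfDE, cinfNE); lra.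
Qed.

Lemma curvature_vertical V Z : P_V V = V -> P_V Z = Z -> curvature D Gamma V Z = 0.
Proof.
move=> VE ZE; rewrite /curvature (massa_pagani_vertical VE ZE).
rewrite massa_pagani_Gamma_S PV_bracket_Gamma_S S_bracket_Gamma_PH; last first.
  by rewrite dt_bracket dtQ -VE dtPV !vf0 subr0.
rewrite (massa_pagani_Gamma_vertical ZE) (massa_pagani_vertical VE (PVPV _)).
(* The vertical part of [Gamma, Q Z] can be added freely, since S kills the bracket of two vertical
   fields. *)
have <- : S (bracket V (bracket Gamma (Q Z))) = S (bracket V (Q (P_V (bracket Gamma Z)))).
  rewrite (bracket_Gamma_Q ZE) bracketDr SD.
  by rewrite (S_bracket_vertical VE (PVPV _)) addr0.
have [Dl _ _] := massa_pagani_linear.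
(* Since [Gamma, V] = P_V [Gamma, V] - Q V, the formulas for a vertical and for a horizontal
   direction apply to the two terms. *)
have -> : D (bracket Gamma V) Z =
    S (bracket (bracket Gamma V + Q V) (Q Z)) - P_V (bracket (Q V) Z).
  have := Dl (-1) (Q V) (P_V (bracket Gamma V)) Z.
  rewrite !scaleN1r [- Q V + _]addrC -bracket_Gamma_vertical // => ->.
  rewrite (massa_pagani_vertical (PVPV _) ZE) -[Q V]PHQ (massa_pagani_H _ ZE) PHQ.
  by rewrite {2}(bracket_Gamma_vertical VE) subrK addrC.
rewrite (jacobi Gamma) !bracketDl !SD -(PV_bracket_Q VE ZE); vf_ring.
Qed.

Lemma curvatureDr nabla X Y U W : linear_connection nabla ->
  curvature nabla X Y (U + W) = curvature nabla X Y U + curvature nabla X Y W.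
Proof. by move=> [_ Dr _]; rewrite /curvature !Dr; vf_ring. Qed.

Lemma curvature_morph nabla (T : vfield M -> vfield M) X Y Z :
  {morph T : U V / U + V} -> {morph T : U / - U} ->
  (forall U V, nabla U (T V) = T (nabla U V)) ->
  curvature nabla X Y (T Z) = T (curvature nabla X Y Z).
Proof. by move=> TD TN DT; rewrite /curvature !DT -!TN -!TD. Qed.

(** Z is split into a multiple f Gamma, the horizontal part Q (S Z) and a vertical part. On f Gamma
    the curvature is Gamma(V f) - V(Gamma f) - [Gamma, V] f = 0 times Gamma; the horizontal part
    reduces to a vertical one because the connection commutes with Q. *)
Lemma massa_pagani_curvature V Z : vertical V -> curvature D Gamma V Z = 0.
Proof.
move=> /verticalP VE; have [Dl Dr Dlb] := massa_pagani_linear.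
have RG f : curvature D Gamma V (f *: Gamma) = 0.
  rewrite /curvature !Dlb !massa_pagani_Gamma !scaler0 !addr0 !Dlb.
  by rewrite !massa_pagani_Gamma !scaler0 !addr0 bracketE; vf_ring.
rewrite (vf_decomposition Z) -QS !(curvatureDr _ _ _ _ massa_pagani_linear) RG add0r.
rewrite (@curvature_morph D Q) ?(curvature_vertical VE) ?PVS ?PVPV ?Q0 ?addr0 //.
- exact: QD.
- exact: QN.
- exact: massa_pagani_Q.
Qed.

Lemma massa_paganiP : massa_pagani_conditions B D.
Proof.
split.
- exact: massa_pagani_Gamma.
- by move=> X Y; rewrite /nabla_dt dt_massa_pagani subrr.
- by move=> X Y; rewrite /nabla_tensor massa_pagani_S subrr.
- by move=> X Y; rewrite /nabla_tensor massa_pagani_Q subrr.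
- exact: massa_pagani_torsion_H.
- exact: massa_pagani_torsion_V.
- by move=> X vX Z; exact: massa_pagani_curvature.
- exact: massa_pagani_vertical_lift.
Qed.

End SodeTensors.

(** * Vertical lifts and uniqueness *)

Section VerticalLift.
Context {R : realType} {n : nat} {M : smooth_manifold R n}.
Local Notation E := (evolution_space M).
Implicit Types (a b c : chart M) (f : Cinf M) (e : E) (s : R).

Lemma transition_differentiable b c (m : M) : chart_dom b m -> chart_dom c m ->
  differentiable (chart_map c \o chart_inv b) (chart_map b m).
Proof.
move=> bm cm; apply: (smooth_differentiable (@chart_transition _ _ M b c)).
by exists m.
Qed.

(* [xi b] lists the components in the chart b of a vector field on M. *)
Definition base_field (xi : chart M -> 'rV[R]_n -> 'rV[R]_n) :=
  (forall b, smooth_on (chart_cod b) (xi b)) /\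
  forall b c m, chart_dom b m -> chart_dom c m ->
    xi c (chart_map c m) =
    'D_(xi b (chart_map b m)) (chart_map c \o chart_inv b) (chart_map b m).

Fact coord_x_row_linear : linear (fun y : coords R n => y.1.2).
Proof. by []. Qed.
Definition coord_x_row : {linear coords R n -> 'rV[R]_n} :=
  HB.pack (fun y : coords R n => y.1.2)
    (GRing.isLinear.Build R (coords R n) 'rV[R]_n _ _ coord_x_row_linear).

Lemma smooth_on_base b (W : normedModType R) (g : 'rV[R]_n -> W) :
  smooth_on (chart_cod b) g -> smooth_on (@adapted_cod _ _ M b) (fun y => g y.1.2).
Proof.
move=> sg k; have oU := @adapted_cod_open _ _ M b.
have Cx := Ck_lin (L := coord_x_row) (@coord_x_continuous R n) oU (Ck_id k _).
exact: (Ck_comp (@row_coordinatized R n) oU _ Cx (sg k)).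
Qed.

Variables (xi : chart M -> 'rV[R]_n -> 'rV[R]_n) (hxi : base_field xi).

(** The conditional respects the convention of [tangent_bundle] that components in charts not
    containing the foot are 0. *)
Definition translate_velocity (v : tangent_bundle M) s b : 'rV[R]_n :=
  velocity v b +
  s *: (if `[< chart_dom b (foot v) >] then xi b (chart_map b (foot v)) else 0).

Fact translate_out v s b : ~ chart_dom b (foot v) -> translate_velocity v s b = 0.
Proof.
by move=> nb; rewrite /translate_velocity velocity_out // asboolF // scaler0 addr0.
Qed.

Fact translate_transition v s b c : chart_dom b (foot v) -> chart_dom c (foot v) ->
  translate_velocity v s c =
  'D_(translate_velocity v s b) (chart_map c \o chart_inv b) (chart_map b (foot v)).
Proof.
move=> bv cv; have df := transition_differentiable bv cv.
rewrite /translate_velocity !asboolT // (velocity_transition bv cv) (hxi.2 _ _ _ bv cv).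
by rewrite !deriveE // linearD linearZ.
Qed.

Definition translate v s : tangent_bundle M :=
  TangentVector (@translate_out v s) (@translate_transition v s).

(* Differentiating along the translations of the fibres makes the vertical lift
   a global object without any reference to the transition maps of E. *)
Definition vlift_op_fun f e : R := 'D_1 (fun s : R => f (e.1, translate e.2 s)) 0.

Definition vlift_expr b (y : coords R n) : coords R n :=
  \sum_i (xi b y.1.2) 0 i *: V_frame i.

Lemma vlift_exprE b y : vlift_expr b y = (0, 0, xi b y.1.2).
Proof. by rewrite /vlift_expr sum_d_uE; congr (_, _, _); apply/rowP => i; rewrite mxE. Qed.

(** In a chart the translations move along the straight line y + s v, with v fixed because xi
    depends on the foot point only. *)
Lemma vlift_op_funE b f g e : local_expr b f g -> adapted_dom b e ->
  vlift_op_fun f e = 'D_(vlift_expr b (adapted_map b e)) g (adapted_map b e).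
Proof.
move=> fg be; rewrite /vlift_op_fun.
set y := adapted_map b e; set v := vlift_expr b y.
have -> : (fun s => f (e.1, translate e.2 s)) = (fun s => g (y + s *: v)).
  apply/funext => s; rewrite (fg.2 _ (be : adapted_dom b (e.1, translate e.2 s))).
  congr g; rewrite /v vlift_exprE /adapted_map /= /translate_velocity asboolT //.
  by congr (_, _, _); rewrite /= ?mulr0 ?scaler0 addr0.
have dg : differentiable g (y + 0 *: v).
  by rewrite scale0r addr0; exact: local_expr_differentiable fg be.
by have [_ ->] := is_derive_line dg; rewrite scale0r addr0.
Qed.

Lemma smooth_vlift_expr b : smooth_on (@adapted_cod _ _ M b) (vlift_expr b).
Proof.
move=> k; have oU := @adapted_cod_open _ _ M b.
apply: (Ck_sumT (f := fun i y => (xi b y.1.2) 0 i *: V_frame i) oU) => i.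
have Cxi := smooth_on_base (hxi.1 b) k.
apply: (Ck_scale oU _ (Ck_cst k _ _)).
exact: (Ck_lin (L := row_coord i) ((@row_coordinatized R n).1 i) oU Cxi).
Qed.

Fact vlift_op_smooth f : vlift_op_fun f \in smooth_fun (M := M).
Proof.
apply/smooth_funP => b; have [g fg] := cinf_expr f b.
exists (fun y => 'D_(vlift_expr b y) g y); split; last by move=> e; exact: vlift_op_funE.
move=> k; apply: (Ck_along coords_coordinatized (@adapted_cod_open _ _ M b) (fg.1 k.+1)).
exact: smooth_vlift_expr.
Qed.

Definition vlift_op f := SmoothFun (vlift_op_smooth f).

Lemma vlift_in_chart b : in_chart b vlift_op (vlift_expr b).
Proof. by split=> [|f g fg e be]; [exact: smooth_vlift_expr | exact: vlift_op_funE]. Qed.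

Definition vlift : vfield M := VField (fun b => ex_intro _ _ (vlift_in_chart b)).

Lemma vertical_lift_vlift : vertical_lift vlift.
Proof. by move=> b; exists (fun z => xi b z.2); exact: vlift_in_chart. Qed.

End VerticalLift.

(** * Vertical fields as combinations of vertical lifts *)

Section ChartFields.
Context {R : realType} {n : nat} {M : smooth_manifold R n}.
Local Notation E := (evolution_space M).
Variables (a : chart M) (chi : 'rV[R]_n -> R).
Hypotheses (schi : smooth_on setT chi) (kchi : compactly_supported_in a chi).
Implicit Types (b c : chart M) (f : Cinf M) (e : E) (U : vfield M) (i j : 'I_n).

Lemma extend0E b (W : normedModType R) (g : 'rV[R]_n -> W) (m : M) : chart_dom b m ->
  extend0 a b chi g (chart_map b m) =
  if `[< chart_dom a m >] then chi (chart_map a m) *: g (chart_map b m) else 0.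
Proof. by move=> bm; rewrite /extend0 chart_mapK. Qed.

(* chi d/dx^i, extended by 0 outside the chart a *)
Definition chart_field i b : 'rV[R]_n -> 'rV[R]_n :=
  extend0 a b chi (fun y => 'D_(delta_mx 0 i) (chart_map b \o chart_inv a)
    (chart_map a (chart_inv b y))).

(** The components in b form the i-th column of the Jacobian of the transition from a to b, times
    chi; the transformation law is the chain rule. *)
Lemma chart_field_base i : base_field (chart_field i).
Proof.
split=> [b|b c m bm cm].
  apply: smooth_extend0 => // k.
  have sD : Ck k (chart_map a @` (chart_dom a `&` chart_dom b))
      ('D_(delta_mx 0 i) (chart_map b \o chart_inv a)).
    by have [_] := @chart_transition _ _ M a b k.+1; apply.
  have maps y : (chart_map b @` (chart_dom b `&` chart_dom a)) y ->
      (chart_map a @` (chart_dom a `&` chart_dom b)) ((chart_map a \o chart_inv b) y).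
    by move=> [m [bm am] <-]; exists m; rewrite /= ?chart_mapK.
  exact: (Ck_comp (@row_coordinatized R n) (@transition_dom_open _ _ M a b) maps
    (chart_transition b a k) sD).
rewrite /chart_field !extend0E //; case: ifPn => [/asboolP am|_]; last first.
  by rewrite derive0.
rewrite !chart_mapK //.
have dab := transition_differentiable am bm.
have dbc : differentiable (chart_map c \o chart_inv b)
    ((chart_map b \o chart_inv a) (chart_map a m)).
  by rewrite /= chart_mapK //; exact: transition_differentiable.
have := derive_comp (delta_mx 0 i) dab dbc; rewrite /= chart_mapK // => E.
rewrite [RHS]deriveE ?linearZ -?deriveE -?E; last 2 first.
  exact: transition_differentiable.
  exact: transition_differentiable.
(* The transition from a to c factors through b only on the overlap of a and b, which is enough for
   derivatives at the point. *)
congr (_ *: _); apply: near_eq_derive.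
have am' : (chart_map a @` (chart_dom a `&` chart_dom b)) (chart_map a m) by exists m.
apply: filterS (open_near (@transition_dom_open _ _ M b a) am') => _ [p [ap bp] <-].
by rewrite /= !chart_mapK.
Qed.

Lemma chart_field_center i (m : M) : chart_dom a m ->
  chart_field i a (chart_map a m) = chi (chart_map a m) *: delta_mx 0 i.
Proof.
move=> am; rewrite /chart_field extend0E // asboolT // chart_mapK //; congr (_ *: _).
have am' : (chart_map a @` (chart_dom a `&` chart_dom a)) (chart_map a m) by exists m.
rewrite -[RHS](derive_id (chart_map a m)); apply: near_eq_derive.
apply: filterS (open_near (@transition_dom_open _ _ M a a) am') => _ [p [ap _] <-].
by rewrite /= chart_mapK.
Qed.

(* chi u^i, extended by 0 outside the chart a *)
Definition chart_velocity_fun i e : R :=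
  if `[< chart_dom a (foot e.2) >]
  then chi (chart_map a (foot e.2)) * velocity e.2 a 0 i else 0.

(** In a chart b, the velocity components relative to a are linear in those relative to b, with the
    Jacobian of the transition as coefficients. *)
Fact chart_velocity_smooth i : chart_velocity_fun i \in smooth_fun (M := M).
Proof.
apply/smooth_funP => b.
pose D j := extend0 a b chi (fun y =>
  'D_(delta_mx 0 j) (chart_map a \o chart_inv b) y).
have sD j : smooth_on (chart_cod b) (D j).
  apply: smooth_extend0 => // k.
  by have [_] := @chart_transition _ _ M b a k.+1; apply.
exists (fun y : coords R n => \sum_j y.2 0 j *: (D j y.1.2) 0 i); split.
  move=> k; have oU := @adapted_cod_open _ _ M b.
  apply: (Ck_sumT (f := fun j (y : coords R n) => y.2 0 j *: (D j y.1.2) 0 i) oU) => j.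
  apply: (Ck_scale oU).
    exact: (Ck_lin ((@coords_coordinatized R n).1 (inr j)) oU (Ck_id k _)).
  exact: (Ck_lin ((@row_coordinatized R n).1 i) oU (smooth_on_base (sD j) k)).
move=> e be; rewrite /chart_velocity_fun /adapted_map /=.
under eq_bigr do rewrite /D extend0E //.
case: ifPn => [/asboolP ae|_]; last first.
  by rewrite big1 // => j _; rewrite mxE scaler0.
rewrite (velocity_transition be ae).
rewrite (derive_coord (@row_coordinatized R n) _ (transition_differentiable be ae)).
rewrite summxE mulr_sumr; apply: eq_bigr => j _.
by rewrite !mxE -[RHS]/(_ * _) mulrCA.
Qed.

Definition chart_velocity i : Cinf M := SmoothFun (chart_velocity_smooth i).

Lemma bump_expr_smooth : smooth_on (@adapted_cod _ _ M a) (fun y => chi y.1.2).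
Proof.
have schi' : smooth_on (chart_cod a) chi by move=> l; apply: Ck_sub (schi l).
exact: smooth_on_base schi'.
Qed.

Lemma chart_velocity_expr i : local_expr a (chart_velocity i)
  (fun y => chi y.1.2 * y.2 0 i).
Proof.
split; last by move=> e ae; rewrite /= /chart_velocity_fun asboolT.
move=> k; have oU := @adapted_cod_open _ _ M a.
apply: (Ck_scale oU (bump_expr_smooth k)).
exact: (Ck_lin ((@coords_coordinatized R n).1 (inr i)) oU (Ck_id k _)).
Qed.

Definition bump_fun e : R :=
  if `[< chart_dom a (foot e.2) >] then chi (chart_map a (foot e.2)) else 0.

Fact bump_fun_smooth : bump_fun \in smooth_fun (M := M).
Proof.
apply/smooth_funP => b.
have s1 := smooth_extend0 schi kchi (@smooth_cst _ _ _
  (chart_map b @` (chart_dom b `&` chart_dom a)) (1 : R)).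
exists (fun y => extend0 a b chi (cst (1 : R)) y.1.2); split; first exact: smooth_on_base.
move=> e be; rewrite /bump_fun /adapted_map /= extend0E //.
by case: ifP => // _; rewrite [RHS]mulr1.
Qed.

Definition bump_cinf : Cinf M := SmoothFun bump_fun_smooth.

(** If U has components w^i in the chart a, then U(chi u^i) = chi w^i, as chi depends on x alone;
    the lifted field brings the second factor chi. *)
Lemma bump_vertical U : vertical U ->
  bump_cinf ^+ 2 *: U = \sum_i U (chart_velocity i) *: vlift (chart_field_base i).
Proof.
move=> vU; apply: vfieldP => f e.
have sumE (r : seq 'I_n) (X : 'I_n -> vfield M) :
    (\sum_(i <- r) X i) f e = \sum_(i <- r) X i f e.
  by elim: r => [|i r IH]; rewrite ?big_nil ?big_cons // vfDE cinfDE IH.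
rewrite sumE vfZE expr2 !cinfME /= {1 2}/bump_fun.
have [ae|nae] := pselect (chart_dom a (foot e.2)); last first.
  rewrite !asboolF // !mul0r big1 // => i _.
  (* Outside a, the lifted field is evaluated in another chart, where its components are 0. *)
  have [b be] := adapted_chart_at e.
  rewrite -[LHS]/(U (chart_velocity i) e * vlift_op_fun (chart_field_base i) f e).
  have [g fg] := cinf_expr f b.
  rewrite (vlift_op_funE _ fg be) vlift_exprE /chart_field extend0E // asboolF //.
  by rewrite (derive0 g) mulr0.
have [w Uw] := vU a; have [g fg] := cinf_expr f a.
rewrite !asboolT // (Uw.2 _ _ fg) //.
have dg := local_expr_differentiable fg ae.
rewrite deriveE // linear_sum mulr_sumr; apply: eq_bigr => i _.
rewrite -[RHS]/(U (chart_velocity i) e * vlift_op_fun (chart_field_base i) f e).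
rewrite (Uw.2 _ _ (chart_velocity_expr i)) // (vlift_op_funE _ fg ae).
rewrite vlift_exprE /adapted_map /= chart_field_center //.
set y := adapted_map a e in dg *; set v := \sum_i _.
have dchi : differentiable (fun z : coords R n => chi z.1.2) y.
  exact: smooth_differentiable bump_expr_smooth (adapted_map_cod ae).
have dL : differentiable (coord_lin (inr i)) y.
  by apply: linear_differentiable; exact: coords_coordinatized.1.
have [_ ->] := diff_scale dchi dL.
have -> : v = (0, 0, w y).
  by rewrite /v sum_d_uE; congr (_, _, _); apply/rowP => j; rewrite mxE.
rewrite (derive_vertical (fun z => chi z.2)).
rewrite (_ : 'D_(0, 0, w y) (coord_lin (inr i)) y = w y 0 i); last exact: derive_coord_u.
rewrite (_ : (0, 0, _ *: delta_mx 0 i) = chi y.1.2 *: V_frame i); last first.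
  by congr (_, _, _); rewrite /= ?mulr0 ?scaler0.
rewrite scale0r add0r deriveE // -/y !linearZ /= -![_ *: _]/(_ * _).
by rewrite /y /adapted_map /=; ring.
Qed.

End ChartFields.

(** * Uniqueness of the connection *)

Section Uniqueness.
Context {R : realType} {n : nat} {M : smooth_manifold R n}.
Variables (Gamma : vfield M) (hGamma : is_sode Gamma) (B : sode_tensors Gamma).
Implicit Types (f h : Cinf M) (X Y Z U V W : vfield M).

Local Notation S := (tS B).
Local Notation Q := (tQ B).
Local Notation P_V := (tPV B).
Local Notation P_H := (tPH B).

(** Y is split as dt(Y) Gamma + Q (S Y) + P_V Y; then the Leibniz rule with parallel Gamma, and
    parallel Q, leave derivatives of the vertical fields S Y and P_V Y only. *)
Lemma connection_decomposition nabla X Y :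
  linear_connection nabla -> massa_pagani_conditions B nabla ->
  nabla X Y = X (dt Y) *: Gamma + Q (nabla X (S Y)) + nabla X (P_V Y).
Proof.
move=> [_ Dr Dlb] [DG _ _ DQ _ _ _ _].
have QE : Q (nabla X (S Y)) = nabla X (Q (S Y)).
  by apply/eqP; rewrite eq_sym -subr_eq0; apply/eqP; exact: DQ.
rewrite {1}(vf_decomposition hGamma B Y) !Dr Dlb DG scaler0 addr0.
by rewrite QE (QS hGamma).
Qed.

Variables (D1 D2 : vfield M -> vfield M -> vfield M).
Hypotheses (lin1 : linear_connection D1) (lin2 : linear_connection D2).
Hypotheses (C1 : massa_pagani_conditions B D1) (C2 : massa_pagani_conditions B D2).

Lemma eq_connection_of_vertical X :
  (forall Z, P_V Z = Z -> D1 X Z = D2 X Z) -> D1 X = D2 X.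
Proof.
move=> D12; apply/funext => Y.
rewrite (connection_decomposition X Y lin1 C1) (connection_decomposition X Y lin2 C2).
by rewrite !D12 ?(PVPV hGamma) ?(PVS hGamma).
Qed.

(** A vertical Z equals S (Q Z). As Gamma is parallel, the torsion condition at Q Z prescribes the
    derivative of Z along Gamma minus [Gamma, Z]. *)
Lemma eq_connection_Gamma : D1 Gamma = D2 Gamma.
Proof.
apply: eq_connection_of_vertical => Z <-; rewrite -(SQ hGamma).
have := torsion_H C1 (Q Z); rewrite (torsion_H C2) /torsion.
by rewrite (nabla_Gamma_eq0 C1) (nabla_Gamma_eq0 C2) !subr0 => /addIr ->.
Qed.

Lemma scaled_difference V f U :
  D1 V (f *: U) - D2 V (f *: U) = f *: (D1 V U - D2 V U).
Proof.
case: lin1 lin2 => [_ _ l1] [_ _ l2].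
by rewrite l1 l2 opprD addrACA subrr add0r scalerBr.
Qed.

Lemma difference_sum V (I : Type) (r : seq I) (F : I -> vfield M) :
  D1 V (\sum_(i <- r) F i) - D2 V (\sum_(i <- r) F i) =
  \sum_(i <- r) (D1 V (F i) - D2 V (F i)).
Proof.
case: lin1 lin2 => [_ a1 l1] [_ a2 l2].
elim: r => [|i r IH]; last by rewrite !big_cons a1 a2 opprD addrACA IH.
by have := scaled_difference V 0 0; rewrite !scale0r !big_nil.
Qed.

Lemma eq_connection_on_vertical V : vertical V -> D1 V = D2 V.
Proof.
move=> vV; apply: eq_connection_of_vertical => U UE.
have vU : vertical U by rewrite -UE; exact: vertical_PV.
apply/eqP; rewrite -subr_eq0; apply/eqP; apply: vfieldP => f e.
have [a ae] := adapted_chart_at e; have [chi [schi chi0 kchi]] := chart_bump ae.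
(* The difference vanishes on the vertical lifts spanning the multiple of U; the factor chi^2 is
   nonzero at e and is cancelled at the end. *)
have H : bump_cinf schi kchi ^+ 2 *: (D1 V U - D2 V U) = 0.
  rewrite -scaled_difference bump_vertical // difference_sum big1 // => i _.
  rewrite scaled_difference (nabla_vertical_lift C1) ?(nabla_vertical_lift C2) //.
  - by rewrite subrr scaler0.
  - exact: vertical_lift_vlift.
  - exact: vertical_lift_vlift.
have := congr1 (fun X : vfield M => X f e) H.
rewrite vfZE expr2 !cinfME /= {1 2}/bump_fun !asboolT // => /eqP.
by rewrite !mulf_eq0 (negbTE chi0) /= => /eqP.
Qed.

Lemma eq_connection_PH W : D1 (P_H W) = D2 (P_H W).
Proof.
apply/funext => Z; set V := S W.
have vV : vertical V by exact: vertical_S.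
(* In the two curvature equations the iterated derivatives agree by the previous cases, so the terms
   along [Gamma, V] agree too. *)
have H : D1 (bracket Gamma V) Z = D2 (bracket Gamma V) Z.
  have := curvature_Gamma_vertical C1 vV Z; have := curvature_Gamma_vertical C2 vV Z.
  rewrite /curvature eq_connection_Gamma eq_connection_on_vertical // => /eqP.
  by rewrite subr_eq0 => /eqP -> /eqP; rewrite subr_eq0 => /eqP.
have PHE D : linear_connection D -> D (P_H W) Z =
    D (P_V (bracket Gamma V)) Z - D (bracket Gamma V) Z.
  move=> [Dl _ _].
  have <- : - bracket Gamma V + P_V (bracket Gamma V) = P_H W.
    by rewrite {1}(bracket_Gamma_S hGamma) opprB subrK.
  have := Dl (-1) (bracket Gamma V) (P_V (bracket Gamma V)) Z.
  by rewrite !scaleN1r => ->; rewrite addrC.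
rewrite !PHE // H eq_connection_on_vertical //; exact: vertical_PV.
Qed.

Lemma massa_pagani_unique X : D1 X = D2 X.
Proof.
apply/funext => Z; have [[l1 _ _] [l2 _ _]] := (lin1, lin2).
rewrite (vf_decomposition hGamma B X) -addrA !l1 !l2.
rewrite eq_connection_Gamma; congr (_ + _).
have := l1 1 (P_H X) (P_V X) Z; rewrite !scale1r => ->.
have := l2 1 (P_H X) (P_V X) Z; rewrite !scale1r => ->.
by rewrite eq_connection_PH eq_connection_on_vertical //; exact: vertical_PV.
Qed.

End Uniqueness.

Theorem proposition3p3 (R : realType) (n : nat) (M : smooth_manifold R n)
    (Gamma : vfield M) (hGamma : is_sode Gamma) (B : sode_tensors Gamma) :
  linear_connection (massa_pagani B) /\
  massa_pagani_conditions B (massa_pagani B) /\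
  (forall nabla : vfield M -> vfield M -> vfield M,
     linear_connection nabla -> massa_pagani_conditions B nabla ->
     forall X Y : vfield M, nabla X Y = massa_pagani B X Y).
Proof.
have lin := massa_pagani_linear hGamma B; have cond := massa_paganiP hGamma B.
split=> //; split=> // nabla nlin ncond X Y.
by rewrite (massa_pagani_unique hGamma nlin lin ncond cond).
Qed.
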